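(* Let $G$ be a locally finite weakly connected digraph, let $s,t \in V(G)\cup\Omega(G)$ with $s\neq t$, and let $F\subseteq E(G)$. Then the following statements are equivalent. (i) $\overline{F}$ contains a directed topological $s$--$t$ walk. (ii) $|F\cap\overrightarrow{E}(X,Y)|\geq 1$ for every finite cut $E(X,Y)$ of $G$ with $s\in\overline{X}$ and $t\in\overline{Y}$. (iii) There is a subset $W\subseteq F$ such that $|W\cap\overrightarrow{E}(X,Y)| = |W\cap\overrightarrow{E}(Y,X)|+1$ for every finite cut $E(X,Y)$ of $G$ with $s\in\overline{X}$ and $t\in\overline{Y}$.
   Context: Digraphs may be infinite and may have parallel edges but no loops. A digraph is weakly connected (locally finite) if its underlying undirected multigraph is connected (has only finite degrees). For disjoint $X,Y\subseteq V(G)$, $\overrightarrow{E}(X,Y)$ is the set of edges with tail in $X$ and head in $Y$, and $E(X,Y)=\overrightarrow{E}(X,Y)\cup\overrightarrow{E}(Y,X)$; it is a cut if $(X,Y)$ is a bipartition of $V(G)$ (with non-empty classes). Ends: a ray is a one-way infinite undirected path; two rays in a multigraph are equivalent if they cannot be separated by finitely many vertices, and the equivalence classes are the ends. The ends of $G$, forming the set $\Omega(G)$, are those of its underlying multigraph $H$. The space $|G|$: for a locally finite weakly connected digraph $G$ with underlying multigraph $H$, $|G|:=|H|$ is the Freudenthal compactification of the $1$-complex of $H$. Its points are the points of the $1$-complex (each edge being a copy of $[0,1]$ joining its endvertices) together with the ends. Points of the $1$-complex have their usual basic neighbourhoods; basic open neighbourhoods of an end $\omega$ are given by finite sets $S\subseteq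 V$ and consist of the component $C$ of $H-S$ in which $\omega$ has a ray, all ends with a ray in $C$, and, for every edge between $C$ and $S$, a half-open partial edge at its endvertex in $C$ (of length $\varepsilon$ for some $\varepsilon\in(0,1]$). $\mathring{e}$ denotes the set of inner points of an edge $e$, and $\mathring{E}$ the union of all $\mathring{e}$, $e\in E(G)$. For a point set, vertex set, edge set or subgraph $Z$, $\overline{Z}$ is the closure in $|G|$ of the set of points corresponding to $Z$. For $X\subseteq V(G)$, $\overline{X}$ is $X$ together with all ends containing a ray that cannot be separated from $X$ by finitely many vertices. Topological walks: for $W\subseteq|G|$ and a linear order $<_W$ on $\mathring{E}\cap W$, the pair $(W,<_W)$ is a topological walk if there is a continuous map $\sigma:[0,1]\to|G|$ (a witness) such that $W$ is the image of $\sigma$, each $p\in\mathring{E}\cap W$ has precisely one preimage under $\sigma$, and for $p,q\in\mathring{E}\cap W$ we have $p<_W q$ if and only if $\sigma^{-1}(p)<\sigma^{-1}(q)$. It is contained in $Z\subseteq |G|$ if $W\subseteq Z$. Each edge $e=uv$ (tail $u$, head $v$) carries the linear order $<_e$ on $\overline{\{e\}}$ induced by any homeomorphism $\varphi_e:[0,1]\to\overline{\{e\}}$ with $\varphi_e(0)=u$, $\varphi_e(1)=v$. A topological walk $(W,<_W)$ is directed if $<_W$ and $<_e$ agree on $\mathring{e}$ for every edge $e\in E(G)$ with $\mathring{e}\cap W\neq\emptyset$. A directed topological $s$--$t$ walk (for $s\ne t$) is one whose witnesses $\sigma$ satisfy $\sigma(0)=s$ and $\sigma(1)=t$. *)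

(* Defs.v *)
From HB Require Import structures.
From mathcomp Require Import all_boot all_order all_algebra finmap lra.
From mathcomp Require Import all_classical all_reals all_analysis.
Set Implicit Arguments.
Unset Strict Implicit.
Unset Printing Implicit Defensive.
Import Order.TTheory GRing.Theory Num.Theory.
Import numFieldNormedType.Exports.
Local Open Scope classical_set_scope.
Local Open Scope ring_scope.

Record digraph := Digraph {
  vertex : choiceType;
  edge : choiceType;
  tail : edge -> vertex;
  head : edge -> vertex;
  no_loop : forall e, tail e <> head e
}.

Section Graph.
Context {G : digraph}.
Implicit Types (u v w : vertex G) (e : edge G) (S C X Y A B : set (vertex G)).

(* The underlying undirected multigraph has the same vertices and edges. *)
Definition joins e u v :=
  (tail e = u /\ head e = v) \/ (tail e = v /\ head e = u).

Inductive connected_avoiding S : vertex G -> vertex G -> Prop :=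
| conn_refl u : ~ S u -> connected_avoiding S u u
| conn_step u v w e : connected_avoiding S u v -> joins e v w -> ~ S w ->
    connected_avoiding S u w.

Definition component_avoiding S C :=
  exists2 u, ~ S u & C = [set w | connected_avoiding S u w].

Definition separates S A B :=
  forall a b, A a -> B b -> ~ connected_avoiding S a b.

Definition finitely_separable A B :=
  exists2 S, finite_set S & separates S A B.

Record ray := Ray {
  ray_vertex : nat -> vertex G;
  ray_edge : nat -> edge G;
  ray_inj : injective ray_vertex;
  ray_joins : forall n,
    joins (ray_edge n) (ray_vertex n) (ray_vertex n.+1)
}.

Definition ray_vertices (r : ray) : set (vertex G) := range (ray_vertex r).

Definition ray_equiv (r r' : ray) :=
  ~ finitely_separable (ray_vertices r) (ray_vertices r').

Record graph_end := GraphEnd {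
  end_rays : set ray;
  end_class : exists r, end_rays = [set r' | ray_equiv r r']
}.

Definition end_has_ray_in (w : graph_end) C :=
  exists2 r, end_rays w r & ray_vertices r `<=` C.

Definition edges_from X Y : set (edge G) :=
  [set e | X (tail e) /\ Y (head e)].

Definition edges_between X Y : set (edge G) :=
  edges_from X Y `|` edges_from Y X.

Definition is_cut X Y :=
  [/\ X !=set0, Y !=set0, X `&` Y = set0 & X `|` Y = setT].

Definition finite_cut X Y := is_cut X Y /\ finite_set (edges_between X Y).

End Graph.
Arguments ray : clear implicits.
Arguments graph_end : clear implicits.

Definition locally_finite (G : digraph) :=
  forall v : vertex G, finite_set [set e | tail e = v \/ head e = v].

Definition weakly_connected (G : digraph) :=
  forall u v : vertex G, connected_avoiding set0 u v.

(* [fset_set A] is empty when [A] is infinite: for finite sets only. *)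
Definition ecard (G : digraph) (A : set (edge G)) : nat := #|` fset_set A|.

(* The points of |G|; [Inner e x] is the point at distance [x] from the tail
   of [e] in the copy of [0, 1] that represents [e]. *)
Inductive fpoint (R : realType) (G : digraph) :=
| Vtx of vertex G
| Inner of edge G & {x : R | 0 < x < 1}
| End of graph_end G.
Arguments Vtx {R G}.
Arguments Inner {R G}.
Arguments End {R G}.

Section Topology.
Context {R : realType} {G : digraph}.
Implicit Types (p q : fpoint R G) (v : vertex G) (e : edge G) (eps : R).

(* The point of [e] with parameter [x] is less than [eps] away from the
   endvertex [v] of [e]. *)
Definition close_to e v (x eps : R) :=
  (tail e = v /\ x < eps) \/ (head e = v /\ 1 - x < eps).

Definition vertex_nbhd v eps : set (fpoint R G) := fun p =>
  match p with
  | Vtx u => u = v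
  | Inner e x => close_to e v (val x) eps
  | End _ => False
  end.

Definition inner_nbhd e (x eps : R) : set (fpoint R G) := fun p =>
  match p with
  | Inner e' y => e' = e /\ `|val y - x| < eps
  | _ => False
  end.

Definition end_nbhd (S C : set (vertex G)) eps : set (fpoint R G) := fun p =>
  match p with
  | Vtx u => C u
  | Inner e x => (C (tail e) /\ C (head e)) \/
      exists u w, [/\ C u, S w, joins e u w & close_to e u (val x) eps]
  | End w => end_has_ray_in w C
  end.

Definition basic_nbhd p (N : set (fpoint R G)) : Prop :=
  match p with
  | Vtx v => exists2 eps, 0 < eps <= 1 & N = vertex_nbhd v eps
  | Inner e x => exists2 eps, 0 < eps <= 1 & N = inner_nbhd e (val x) eps
  | End w => exists S C eps, [/\ finite_set S, component_avoiding S C,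
      end_has_ray_in w C, 0 < eps <= 1 & N = end_nbhd S C eps]
  end.

Definition fopen (U : set (fpoint R G)) :=
  forall p, U p -> exists2 N, basic_nbhd p N & N `<=` U.

End Topology.

Section TopologyFacts.
Context {G : digraph}.
Implicit Types (u v w : vertex G) (S C : set (vertex G)).

Lemma joins_sym (e : edge G) u v : joins e u v -> joins e v u.
Proof. by case; [right|left]. Qed.

Lemma conn_avoidl S u v : connected_avoiding S u v -> ~ S u.
Proof. by elim. Qed.

Lemma conn_avoidr S u v : connected_avoiding S u v -> ~ S v.
Proof. by case. Qed.

Lemma conn_trans S u v w : connected_avoiding S u v ->
  connected_avoiding S v w -> connected_avoiding S u w.
Proof.
move=> uv vw; elim: vw uv => [//|x y z e _ IH yz Sz /IH uy].
exact: conn_step uy yz Sz.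
Qed.

Lemma conn_sym S u v : connected_avoiding S u v -> connected_avoiding S v u.
Proof.
elim=> [x Sx|x y z e xy yx yz Sz]; first exact: conn_refl.
apply: conn_trans yx; apply: (conn_step (conn_refl Sz) (joins_sym yz)).
exact: conn_avoidr xy.
Qed.

Lemma conn_sub S S' u v : S `<=` S' ->
  connected_avoiding S' u v -> connected_avoiding S u v.
Proof.
move=> SS'; elim=> [x Sx|x y z e _ xy yz Sz]; first by apply: conn_refl => /SS'.
by apply: (conn_step xy yz) => /SS'.
Qed.

Lemma ray_conn S (r : ray G) n m : (forall k, (n <= k)%N -> ~ S (ray_vertex r k)) ->
  (n <= m)%N -> connected_avoiding S (ray_vertex r n) (ray_vertex r m).
Proof.
move=> rS /subnKC <-; elim: (m - n)%N => [|k IH].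
  by rewrite addn0; apply: conn_refl; exact: rS.
rewrite addnS; apply: (conn_step IH (ray_joins r _)).
by rewrite -addnS; apply: rS; exact: leq_addr.
Qed.

Lemma ray_avoid S (r : ray G) : finite_set S ->
  exists n, forall k, (n <= k)%N -> ~ S (ray_vertex r k).
Proof.
move=> fS.
have : finite_set (ray_vertex r @^-1` S).
  apply: finite_preimage => //; move=> x y _ _; exact: (@ray_inj _ r).
move=> /finite_fsetP[X XE].
exists (\max_(i <- X) i).+1 => k nk Sk.
have kX : k \in X by have : (ray_vertex r @^-1` S) k by []; rewrite XE.
by move: nk; rewrite ltnNge (big_rem k) //= leq_maxl.
Qed.

Fact ray_drop_inj (r : ray G) n :
  injective (fun k => ray_vertex r (n + k)%N).
Proof. by move=> i j /(@ray_inj _ r)/addnI. Qed.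

Fact ray_drop_joins (r : ray G) n k : joins (ray_edge r (n + k)%N)
  (ray_vertex r (n + k)%N) (ray_vertex r (n + k.+1)%N).
Proof. by rewrite addnS; exact: ray_joins. Qed.

Definition ray_drop (r : ray G) n :=
  Ray (@ray_drop_inj r n) (@ray_drop_joins r n).

(* Equivalent rays have tails in the same component, for every finite [S]. *)
Lemma ray_equivP (r r' : ray G) : ray_equiv r r' <->
  forall S n, finite_set S -> exists k k',
    [/\ (n <= k)%N, (n <= k')%N &
      connected_avoiding S (ray_vertex r k) (ray_vertex r' k')].
Proof.
split=> [rr' S n fS|H [S fS sep]]; last first.
  have [k [k' [_ _]]] := H S 0%N fS.
  by apply: sep; [exists k|exists k'].
apply: contrapT => H; apply: rr'.
exists (S `|` (ray_vertex r @` `I_n `|` ray_vertex r' @` `I_n)).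
  by rewrite !finite_setU; split=> //; split; exact: finite_image.
move=> _ _ [k _ <-] [k' _ <-] c; apply: H; exists k, k'; split.
- by rewrite leqNgt; apply/negP => kn; apply: (conn_avoidl c); right; left; exists k.
- by rewrite leqNgt; apply/negP => kn; apply: (conn_avoidr c); right; right; exists k'.
- by apply: conn_sub c => x; left.
Qed.

Lemma ray_equiv_refl (r : ray G) : ray_equiv r r.
Proof.
apply/ray_equivP => S n /(ray_avoid r)[m rm]; exists (maxn n m), (maxn n m).
by rewrite leq_maxl; split=> //; apply: conn_refl; apply: rm; exact: leq_maxr.
Qed.

Lemma ray_equiv_sym (r r' : ray G) : ray_equiv r r' -> ray_equiv r' r.
Proof.
move=> /ray_equivP H; apply/ray_equivP => S n /(H _ n)[k [k' [? ? /conn_sym ?]]].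
by exists k', k.
Qed.

Lemma ray_equiv_trans (r1 r2 r3 : ray G) :
  ray_equiv r1 r2 -> ray_equiv r2 r3 -> ray_equiv r1 r3.
Proof.
move=> /ray_equivP H12 /ray_equivP H23; apply/ray_equivP => S n fS.
have [m rm] := ray_avoid r2 fS.
have [a [b [na nb ab]]] := H12 S (maxn n m) fS.
have [c [d [nc nd cd]]] := H23 S (maxn n m) fS.
move: na nb nc nd; rewrite !geq_max => /andP[na _] /andP[_ mb] /andP[_ mc] /andP[nd _].
exists a, d; split=> //; apply: conn_trans ab (conn_trans _ cd).
case/orP: (leq_total b c) => [bc|cb].
- by apply: ray_conn => // k /(leq_trans mb)/rm.
- by apply/conn_sym/ray_conn => // k /(leq_trans mc)/rm.
Qed.

Lemma ray_drop_equiv (r : ray G) n : ray_equiv r (ray_drop r n).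
Proof.
apply/ray_equivP => S m /(ray_avoid r)[l rl].
exists (n + maxn m l)%N, (maxn m l); rewrite leq_maxl.
have h : (maxn m l <= n + maxn m l)%N by exact: leq_addl.
split=> //; first by apply: leq_trans h; exact: leq_maxl.
by apply: conn_refl; apply: rl; apply: leq_trans h; exact: leq_maxr.
Qed.

Lemma end_equiv (w : graph_end G) (r r' : ray G) :
  end_rays w r -> end_rays w r' -> ray_equiv r r'.
Proof.
case: (end_class w) => r0 -> /= /ray_equiv_sym; exact: ray_equiv_trans.
Qed.

Lemma end_closed (w : graph_end G) (r r' : ray G) :
  end_rays w r -> ray_equiv r r' -> end_rays w r'.
Proof. case: (end_class w) => r0 -> /=; exact: ray_equiv_trans. Qed.

Lemma component_sub S S' C C' u : S `<=` S' ->
  component_avoiding S C -> component_avoiding S' C' -> C u -> C' u ->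
  C' `<=` C.
Proof.
move=> SS' [x Sx ->] [y Sy ->] /= xu yu z /= yz.
exact: conn_trans xu (conn_sub SS' (conn_trans (conn_sym yu) yz)).
Qed.

Lemma component_step S C e u v : component_avoiding S C ->
  C u -> joins e u v -> S v \/ C v.
Proof.
move=> [x Sx ->] /= xu uv; have [Sv|Sv] := pselect (S v); [by left|right].
exact: conn_step xu uv Sv.
Qed.

Lemma component_disj S C u : component_avoiding S C -> C u -> ~ S u.
Proof. by move=> [x Sx ->] /= /conn_avoidr. Qed.

Lemma end_component (w : graph_end G) S : finite_set S ->
  exists2 C, component_avoiding S C & end_has_ray_in w C.
Proof.
move=> fS; case: (end_class w) => r wE.
have wr : end_rays w r by rewrite wE; exact: ray_equiv_refl.
have [n rn] := ray_avoid r fS.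
exists [set u | connected_avoiding S (ray_vertex r n) u].
  by exists (ray_vertex r n) => //; exact: rn.
exists (ray_drop r n); first exact: end_closed wr (@ray_drop_equiv r n).
by move=> _ [k _ <-] /=; apply: ray_conn => //; exact: leq_addr.
Qed.

(* The component in which an end has a ray contains tails of all its rays. *)
Lemma end_component_sub (w : graph_end G) S S' C C' :
  finite_set S' -> S `<=` S' ->
  component_avoiding S C -> component_avoiding S' C' ->
  end_has_ray_in w C -> end_has_ray_in w C' -> C' `<=` C.
Proof.
move=> fS' SS' cC cC' [r wr rC] [r' wr' rC'].
have /ray_equivP/(_ S' 0%N fS')[k [k' [_ _ c]]] := end_equiv wr wr'.
have C'k' : C' (ray_vertex r' k') by apply: rC'; exists k'.
apply: (component_sub SS' cC cC' (u := ray_vertex r k)); first by apply: rC; exists k.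
by case: cC' C'k' => x _ -> /= /conn_trans; apply; exact: conn_sym.
Qed.

End TopologyFacts.

Section SpaceTopology.
Context {R : realType} {G : digraph}.
Implicit Types (p q : fpoint R G) (v : vertex G) (e : edge G) (eps : R).

Lemma close_toW e v (x d d' : R) :
  d <= d' -> close_to e v x d -> close_to e v x d'.
Proof.
by move=> dd [[? h]|[? h]]; [left|right]; split=> //; exact: lt_le_trans h dd.
Qed.

Lemma end_nbhdS (S S' C C' : set (vertex G)) (d d' : R) :
  S `<=` S' -> C' `<=` C -> component_avoiding S C -> d' <= d ->
  @end_nbhd R G S' C' d' `<=` end_nbhd S C d.
Proof.
move=> SS' CC cC dd [u|e x|w] /=; first exact: CC.
- case=> [[? ?]|[u [w [Cu Sw euw c]]]]; first by left; split; exact: CC.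
  have [Sw'|Cw] := component_step cC (CC _ Cu) euw.
    by right; exists u, w; split=> //; [exact: CC|exact: close_toW c].
  by left; case: euw => -[-> ->]; split=> //; exact: CC.
- by move=> [r wr rC]; exists r => //; exact: subset_trans CC.
Qed.

Lemma basic_nbhd_ex p : exists N, basic_nbhd p N.
Proof.
have h : 0 < (1 : R) <= 1 by rewrite ltr01 lexx.
case: p => [v|e x|w] /=; [by eexists; exists 1|by eexists; exists 1|].
have [C cC wC] := end_component w (finite_set0 (vertex G)).
by exists (end_nbhd set0 C 1), set0, C, 1.
Qed.

Lemma basic_nbhdI p N N' : basic_nbhd p N -> basic_nbhd p N' ->
  exists2 M, basic_nbhd p M & M `<=` N `&` N'.
Proof.
have minP (a b : R) : 0 < a <= 1 -> 0 < b <= 1 -> 0 < Num.min a b <= 1.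
  by move=> /andP[a0 a1] /andP[b0 b1]; rewrite lt_min a0 b0 ge_min a1.
case: p => [v|e x|w] /=.
- move=> [a ha ->] [b hb ->].
  exists (vertex_nbhd v (Num.min a b)); first by exists (Num.min a b) => //; exact: minP.
  case=> [u|e x|w] //= c.
  by split; apply: close_toW c; rewrite ge_min lexx ?orbT.
- move=> [a ha ->] [b hb ->].
  exists (inner_nbhd e (val x) (Num.min a b)).
    by exists (Num.min a b) => //; exact: minP.
  by case=> [u|e' y|w] //= [-> ]; rewrite lt_min => /andP[].
- move=> [S1 [C1 [a [fS1 cC1 wC1 ha ->]]]] [S2 [C2 [b [fS2 cC2 wC2 hb ->]]]].
  have fS : finite_set (S1 `|` S2) by rewrite finite_setU.
  have [C cC wC] := end_component w fS.
  exists (end_nbhd (S1 `|` S2) C (Num.min a b)).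
    by exists (S1 `|` S2), C, (Num.min a b); split=> //; exact: minP.
  have s1 : S1 `<=` S1 `|` S2 by move=> ?; left.
  have s2 : S2 `<=` S1 `|` S2 by move=> ?; right.
  rewrite subsetI; split; apply: end_nbhdS => //.
  + exact: end_component_sub fS s1 cC1 cC wC1 wC.
  + by rewrite ge_min lexx.
  + exact: end_component_sub fS s2 cC2 cC wC2 wC.
  + by rewrite ge_min lexx orbT.
Qed.

Fact fopenT : fopen [set: fpoint R G].
Proof. by move=> p _; have [N ?] := basic_nbhd_ex p; exists N. Qed.

Fact fopenI : setI_closed (@fopen R G).
Proof.
move=> A B oA oB p [/oA[N bN NA] /oB[N' bN' N'B]].
have [M bM MNN'] := basic_nbhdI bN bN'; exists M => //.
by move=> q /MNN'[/NA ? /N'B].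
Qed.

Fact fopen_bigU (I : Type) (f : I -> set (fpoint R G)) :
  (forall i, fopen (f i)) -> fopen (\bigcup_i f i).
Proof.
move=> of_ p [i _ /of_[N bN Nf]]; exists N => // q /Nf ?.
by exists i.
Qed.

End SpaceTopology.

HB.instance Definition _ (R : realType) (G : digraph) :=
  gen_eqMixin (fpoint R G).
HB.instance Definition _ (R : realType) (G : digraph) :=
  gen_choiceMixin (fpoint R G).
HB.instance Definition _ (R : realType) (G : digraph) :=
  isOpenTopological.Build (fpoint R G) fopenT fopenI fopen_bigU.

Section OpenNeighbourhoods.
Context {R : realType} {G : digraph}.
Implicit Types (p q : fpoint R G) (v : vertex G) (e : edge G) (eps : R).

Lemma close_to_nbhd e v (x : {x : R | 0 < x < 1}) eps : eps <= 1 ->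
  close_to e v (val x) eps -> exists2 d, 0 < d <= 1 &
  forall y : R, `|y - val x| < d -> close_to e v y eps.
Proof.
move=> e1; have /andP[x0 x1] := valP x.
case=> [[ev xe]|[ev xe]].
- exists (eps - val x); first by lra.
  by move=> y /ltr_normlP[? ?]; left; split=> //; lra.
- exists (eps - (1 - val x)); first by lra.
  by move=> y /ltr_normlP[? ?]; right; split=> //; lra.
Qed.

Lemma basic_nbhd_open p (N : set (fpoint R G)) : basic_nbhd p N -> open N.
Proof.
suff: basic_nbhd p N -> fopen N by [].
case: p => [v|e x|w] /=.
- move=> [d /andP[d0 d1] ->] [u|e x|w] //=.
  + by move=> ->; exists (vertex_nbhd v d) => //; exists d; rewrite ?d0.
  + move=> /(close_to_nbhd d1)[c ? H]; exists (inner_nbhd e (val x) c); first by exists c.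
    by move=> [u|e' y|w] //= [->] /H.
- move=> [d /andP[d0 d1] ->] [u|e' y|w] //= [-> H].
  exists (inner_nbhd e (val y) (d - `|val y - val x|)).
    exists (d - `|val y - val x|) => //; rewrite subr_gt0 H /=.
    by rewrite (le_trans _ d1)// gerBl.
  move=> [u|f z|w] //= [-> K]; split=> //.
  rewrite (le_lt_trans (ler_distD (val y) _ _))//.
  by rewrite -ltrBrDr.
- move=> [S [C [d [fS cC wC /andP[d0 d1] ->]]]] [u|e x|w'] /=.
  + move=> Cu; exists (vertex_nbhd u d); first by exists d; rewrite ?d0.
    move=> [v ->//|e x|//] /= c.
    have [a ea] : exists a, joins e u a.
      by case: c => -[? _]; [exists (head e); left|exists (tail e); right].
    have [Sa|Ca] := component_step cC Cu ea.
      by right; exists u, a.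
    by left; case: ea => -[-> ->].
  + case=> [tC|[u [a [Cu Sa ea c]]]].
      exists (inner_nbhd e (val x) 1); first by exists 1 => //; rewrite ltr01 lexx.
      by move=> [u|f z|a] //= [-> _]; left.
    have [b ? H] := close_to_nbhd d1 c.
    exists (inner_nbhd e (val x) b); first by exists b.
    by move=> [v|f z|a'] //= [-> /H]; right; exists u, a.
  + move=> wC'; exists (end_nbhd S C d) => //.
    by exists S, C, d; rewrite d0.
Qed.

End OpenNeighbourhoods.

Section Walks.
Context {R : realType} {G : digraph}.
Implicit Types (p q s t : fpoint R G) (e : edge G) (W Z : set (fpoint R G)).
Implicit Types (lt : fpoint R G -> fpoint R G -> Prop) (sigma : R -> fpoint R G).

(* On [0, 1], the canonical homeomorphism to the closed edge [e]; constant on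
   each side of [0, 1]. *)
Definition edge_point e (x : R) : fpoint R G :=
  if insub x is Some y then Inner e y
  else Vtx (if x <= 0 then tail e else head e).

Lemma edge_point_continuous e : continuous (edge_point e : R -> fpoint R G).
Proof.
apply/continuousP => U oU; have {}oU : fopen U by [].
rewrite openE => x /= Ux; rewrite /interior /=.
have main d (d0 : 0 < d) : (forall y, `|x - y| < d -> U (edge_point e y)) ->
  nbhs x (edge_point e @^-1` U).
  by move=> H; apply/nbhs_ballP; exists d => // y /H.
have [N bN NU] := oU _ Ux; move: bN Ux.
rewrite {1 2}/edge_point; case: insubP => [y /andP[y0 y1] yx|xn] /=.
  move=> [d /andP[d0 d1] NE] _; apply: (main (Num.min d (Num.min x (1 - x)))).
    by rewrite !lt_min d0 y0 subr_gt0.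
  move=> z; rewrite !lt_min => /and3P[zd /ltr_normlP[a1 a2] /ltr_normlP[a3 a4]].
  have z01 : 0 < z < 1 by lra.
  rewrite /edge_point insubT; apply: NU; rewrite NE /= yx; split=> //.
  by rewrite distrC.
move=> [d /andP[d0 d1] NE] _; apply: (main d) => // z /ltr_normlP[a1 a2].
apply: NU; rewrite NE /edge_point.
case: insubP => [y /andP[y0 y1] yz|zn] /=.
  case: ifP xn => x0 xn; [left|right]; split=> //; rewrite yz; first by lra.
  rewrite negb_and -!leNgt in xn; case/orP: xn => xn; lra.
move: xn zn; rewrite !negb_and -!leNgt.
case: (leP z 0) => z0; case: (leP x 0) => x0 //= xn zn; exfalso; lra.
Qed.

Lemma edge_point_inj e : {in `[0%R, 1%R] &, injective (edge_point e : R -> fpoint R G)}.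
Proof.
move=> x y; rewrite !in_itv /= => /andP[x0 x1] /andP[y0 y1]; rewrite /edge_point.
case: insubP => [a _ <-|xn]; case: insubP => [b _ <-|yn] //; first by case=> ->.
have te := @no_loop G e.
move: xn yn; rewrite !negb_and -!leNgt.
case: (leP x 0) => a; case: (leP y 0) => b /= xn yn H; try lra.
- by case: H => /te.
- by case: H => /esym/te.
Qed.
Definition edge_set_points (F : set (edge G)) : set (fpoint R G) :=
  [set p | exists e x, [/\ F e, 0 <= x <= 1 & edge_point e x = p]].

Definition edge_set_closure (F : set (edge G)) : set (fpoint R G) :=
  closure (edge_set_points F).

Definition vertices_and_ends : set (fpoint R G) := range Vtx `|` range End.

Definition vertex_set_closure (X : set (vertex G)) : set (fpoint R G) :=
  (Vtx @` X) `|` [set p | exists w r,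
    [/\ p = End w, end_rays w r & ~ finitely_separable (ray_vertices r) X]].

Definition inner_edge e : set (fpoint R G) := range (Inner e).

Definition inner_points : set (fpoint R G) := \bigcup_e inner_edge e.

(* Any homeomorphism from [0, 1] to the closed edge [e] that maps 0 to its tail
   and 1 to its head induces the same order as [edge_point e]. *)
Definition edge_lt e p q := exists x y,
  [/\ 0 <= x <= 1, 0 <= y <= 1, edge_point e x = p, edge_point e y = q & x < y].

Definition strict_linear_order_on (A : set (fpoint R G)) lt :=
  [/\ forall p, A p -> ~ lt p p,
      forall p q r, A p -> A q -> A r -> lt p q -> lt q r -> lt p r &
      forall p q, A p -> A q -> p <> q -> lt p q \/ lt q p].

(* Only the restriction of [lt] to [inner_points `&` W] matters. *)
Definition is_witness W lt sigma :=
  [/\ {within `[0, 1], continuous sigma},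
      W = sigma @` `[0, 1],
      forall p, (inner_points `&` W) p ->
        exists! x : R, 0 <= x <= 1 /\ sigma x = p &
      forall x y, 0 <= x <= 1 -> 0 <= y <= 1 ->
        inner_points (sigma x) -> inner_points (sigma y) ->
        (lt (sigma x) (sigma y) <-> x < y)].

Definition topological_walk W lt :=
  strict_linear_order_on (inner_points `&` W) lt /\
  exists sigma, is_witness W lt sigma.

Definition directed W lt := forall e, inner_edge e `&` W !=set0 ->
  forall p q, (inner_edge e `&` W) p -> (inner_edge e `&` W) q ->
    (lt p q <-> edge_lt e p q).

Definition directed_topological_walk s t W lt :=
  [/\ topological_walk W lt, directed W lt &
      forall sigma, is_witness W lt sigma -> sigma 0 = s /\ sigma 1 = t].

Definition contains_directed_topological_walk Z s t :=
  exists W lt, W `<=` Z /\ directed_topological_walk s t W lt.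

End Walks.

(* Main.v *)
(* The union [gball n] of the spheres of radius at most [n] around a vertex is
   finite; contracting the components of [G - gball n] gives a digraph [G_n] with
   finitely many edges that are not loops, and [|G|] is the inverse limit of the
   [G_n]. Under (ii), reachability in [G_n] along [F] yields an s-t trail in
   each [G_n], and an ultrafilter selects trails [P n] such that [P n] is what
   remains of [P m] in [G_n] for all [n <= m]. The union of the [P n] satisfies
   (iii), because a trail crosses a cut between its ends once more often forwards
   than backwards. The trails order this union linearly; giving the [i]-th
   edge a time interval of length [2^-(i+1)], in this order, and sending every
   other time to the limit of the classes that the [P n] have reached by then
   gives a directed topological s-t walk.

   Conversely, a finite cut [(X, Y)] defines a continuous height on [|G|] that
   is 0 on the side of [X], 1 on the side of [Y] and linear on the edges. Where
   the height of a walk first reaches 1/2, the walk is in an edge that it runs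
   through from [X] to [Y]. *)
From mathcomp Require Import all_boot all_order all_algebra finmap zify ring lra.
From mathcomp Require Import all_classical all_reals all_analysis.
(* Last, because [seq.head] would hide [Defs.head]. *)
Require Import Defs.
Set Implicit Arguments.
Unset Strict Implicit.
Unset Printing Implicit Defensive.
Import Order.TTheory GRing.Theory Num.Theory.
Import numFieldNormedType.Exports.
Local Open Scope classical_set_scope.

(** A finite union belongs to an ultrafilter only if one of its parts does. This replaces the
    repeated passing to subsequences in the compactness arguments below. *)
Lemma ultra_fin (U : set_system nat) (T : choiceType) (l : seq T) (f : nat -> T) :
  UltraFilter U -> U [set n | f n \in l] -> exists p, U [set n | f n = p].
Proof.
move=> UU; elim: l => [|x l IH] Ul.
  by have [n] := filter_ex Ul.
have [?|nx] := in_ultra_setVsetC [set n | f n = x] UU; first by exists x.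
apply: IH; apply: filterS (filterI Ul nx) => n /= [].
by rewrite inE => /orP[/eqP ->//|].
Qed.

(** * Contracting the components outside a ball *)

Section Exhaustion.
Context {G : digraph} (v0 : vertex G).
Implicit Types (u v : vertex G) (n m : nat).

Fixpoint gball n : set (vertex G) :=
  if n is m.+1 then
    gball m `|` [set v | exists2 u, gball m u & exists e, joins e u v]
  else [set v0].

Definition node := (vertex G + graph_end G)%type.
Implicit Types p q : node.

(* Empty if [v] is in the ball. *)
Definition cpt n v : set (vertex G) := [set u | connected_avoiding (gball n) v u].

(* The vertex of the digraph obtained by contracting the components of
   [G - gball n] to which [p] is mapped, as a set of vertices of [G]. *)
Definition cls n p : set (vertex G) :=
  match p with
  | inl v => [set u | u = v \/ cpt n v u]
  | inr w => [set v | end_has_ray_in w (cpt n v)]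
  end.

Definition nonloop n (e : edge G) : bool :=
  `[< cls n (inl (tail e)) <> cls n (inl (head e)) >].

(* Consecutive edges need only meet in the digraph that [cls n] describes. *)
Fixpoint walk n p (es : seq (edge G)) q : Prop :=
  if es is e :: es' then
    cls n p = cls n (inl (tail e)) /\ walk n (inl (head e)) es' q
  else cls n p = cls n q.

Lemma ball_le n m : (n <= m)%N -> gball n `<=` gball m.
Proof.
move=> /subnKC <-; elim: (m - n)%N => [|k IH]; first by rewrite addn0.
by rewrite addnS => v /IH; left.
Qed.

Lemma cpt_refl n v : ~ gball n v -> cpt n v v.
Proof. exact: conn_refl. Qed.

Lemma cpt_eq n u v : cpt n v u -> cpt n v = cpt n u.
Proof.
move=> vu; apply/seteqP; split=> x /=; last exact: conn_trans.
exact: conn_trans (conn_sym vu).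
Qed.

Lemma cpt_component n v : ~ gball n v -> component_avoiding (gball n) (cpt n v).
Proof. by move=> ?; exists v. Qed.

Lemma cpt_le n m v : (n <= m)%N -> cpt m v `<=` cpt n v.
Proof. by move=> nm u; apply: conn_sub; exact: ball_le. Qed.

Lemma cls_le n m p : (n <= m)%N -> cls m p `<=` cls n p.
Proof.
move=> nm; case: p => [v|w] u /=.
  by case=> [|/(cpt_le nm)]; [left|right].
by move=> [r wr ru]; exists r => // x /ru/(cpt_le nm).
Qed.

Lemma cls_inl n u v : cpt n v u -> cls n (inl v) = cpt n v.
Proof.
move=> /conn_avoidl/cpt_refl vv; apply/seteqP; split=> x /=; last by right.
by case=> [->|].
Qed.

Lemma cls_notball n v : ~ gball n v -> cls n (inl v) = cpt n v.
Proof. by move=> /cpt_refl; exact: cls_inl. Qed.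

Lemma cls_refl n v : cls n (inl v) v.
Proof. by left. Qed.

Hypothesis lf : locally_finite G.

Lemma ball_finite n : finite_set (gball n).
Proof.
elim: n => [|n IH] /=; first exact: finite_set1.
rewrite finite_setU; split=> //.
suff: finite_set (\bigcup_(u in gball n)
  ((@head G) @` [set e | tail e = u \/ head e = u] `|`
   (@tail G) @` [set e | tail e = u \/ head e = u])).
  apply: sub_finite_set => v [u bu [e euv]]; exists u => //.
  by case: euv => -[tu hu]; [left|right]; exists e => //; [left|right].
apply: bigcup_finite => // u _; rewrite finite_setU; split; exact/finite_image/lf.
Qed.

Lemma inr_cpt_eq n (w : graph_end G) u v :
  end_has_ray_in w (cpt n u) -> end_has_ray_in w (cpt n v) -> cpt n u = cpt n v.
Proof.
have nb x : end_has_ray_in w (cpt n x) -> ~ gball n x.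
  move=> [r _ rx]; have /rx/conn_avoidl : ray_vertices r (ray_vertex r 0) by exists 0%N.
  exact.
move=> wu wv; have := ball_finite n => fn.
have [cu cv] := (cpt_component (nb _ wu), cpt_component (nb _ wv)).
have ss : gball n `<=` gball n by [].
by apply/seteqP; split; [exact: (end_component_sub fn ss cv cu wv wu)
  |exact: (end_component_sub fn ss cu cv wu wv)].
Qed.

Lemma cls_inr n (w : graph_end G) v : cls n (inr w) v ->
  ~ gball n v /\ cls n (inr w) = cpt n v.
Proof.
move=> /= wv; have nv : ~ gball n v.
  case: wv => r _ rv; have /rv/conn_avoidl : ray_vertices r (ray_vertex r 0) by exists 0%N.
  exact.
split=> //; apply/seteqP; split=> u /=; last by move=> /cpt_eq <-.
move=> wu; rewrite -(inr_cpt_eq wu wv) /=; apply: cpt_refl.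
case: wu => r _ rv; have /rv/conn_avoidl : ray_vertices r (ray_vertex r 0) by exists 0%N.
exact.
Qed.

Lemma cls_eq n p v : cls n p v -> cls n p = cls n (inl v).
Proof.
case: p => [u|w].
  by case=> [->//|uv]; rewrite (cls_inl uv) (cpt_eq uv) (cls_inl (conn_sym uv)).
by move=> /cls_inr[? ->]; rewrite cls_notball.
Qed.

Lemma cls_ex n p : exists v, cls n p v.
Proof.
case: p => [v|w]; first by exists v; left.
have [C [x Sx CE] wC] := end_component w (ball_finite n).
by exists x; rewrite /= /cpt -CE.
Qed.

Lemma cls_common n p q v : cls n p v -> cls n q v -> cls n p = cls n q.
Proof. by move=> /cls_eq -> /cls_eq ->. Qed.

Lemma cls_mono n m p q : (n <= m)%N -> cls m p = cls m q -> cls n p = cls n q.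
Proof.
move=> nm pq; have [v pv] := cls_ex m p; apply: (@cls_common n p q v).
  exact: cls_le pv.
by apply: (cls_le nm); rewrite -pq.
Qed.

Lemma cls_ball n p v : gball n v -> cls n p v -> p = inl v.
Proof.
case: p => [u|w] bv; last by move=> /cls_inr[].
by case=> [->//|/conn_avoidr].
Qed.

Lemma cls_notballP n p v : ~ gball n v -> cls n p v -> cls n p = cpt n v.
Proof. by move=> nv /cls_eq ->; exact: cls_notball. Qed.

Lemma cls_edge n e : ~ gball n (tail e) -> ~ gball n (head e) ->
  cls n (inl (tail e)) = cls n (inl (head e)).
Proof.
move=> nt nh; rewrite cls_notball// cls_notball//; apply: cpt_eq.
by apply: conn_step (conn_refl nt) _ nh; left.
Qed.

(** A vertex of the ball is alone in its class, while an edge outside the ball lies within one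
    component. *)
Lemma nonloopP n e : nonloop n e <-> gball n (tail e) \/ gball n (head e).
Proof.
split=> [/asboolP H|H].
  apply: contrapT => /not_orP[? ?]; apply: H; exact: cls_edge.
apply/asboolP => E; apply: (@no_loop G e).
case: H => b.
- have : cls n (inl (head e)) (tail e) by rewrite -E; exact: cls_refl.
  by move=> /(cls_ball b) [].
- have : cls n (inl (tail e)) (head e) by rewrite E; exact: cls_refl.
  by move=> /(cls_ball b) [].
Qed.

Lemma loop_cls n e : ~~ nonloop n e -> cls n (inl (tail e)) = cls n (inl (head e)).
Proof. by move=> /asboolPn/contrapT. Qed.

Lemma nonloop_mono n m e : (n <= m)%N -> nonloop n e -> nonloop m e.
Proof. by move=> nm /nonloopP[b|b]; apply/nonloopP; [left|right]; exact: ball_le b. Qed.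

Lemma nonloop_finite n : finite_set [set e | nonloop n e].
Proof.
suff: finite_set (\bigcup_(u in gball n) [set e | tail e = u \/ head e = u]).
  by apply: sub_finite_set => e /= /nonloopP[b|b]; eexists; eauto; [left|right].
by apply: bigcup_finite => [|u _]; [exact: ball_finite|exact: lf].
Qed.

Arguments cls : simpl never.

Lemma walk_start n p p' es q : cls n p = cls n p' -> walk n p es q -> walk n p' es q.
Proof. by move=> pp'; case: es => [|e es] /=; rewrite pp'. Qed.

Lemma walk_end n p es q q' : cls n q = cls n q' -> walk n p es q -> walk n p es q'.
Proof.
by move=> qq'; elim: es p => [|e es IH] p /=; [rewrite qq'|move=> [? /IH]].
Qed.

Lemma walk_cat n p es es' q : walk n p (es ++ es') q <->
  exists2 z, walk n p es z & walk n z es' q.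
Proof.
elim: es p => [|e es IH] p /=.
  split=> [h|[z zp h]]; first by exists p.
  by apply: walk_start h.
split=> [[pe /IH[z ? ?]]|[z [? ?] ?]]; first by exists z.
by split=> //; apply/IH; exists z.
Qed.

Lemma walk_end_eq n p es q q' : walk n p es q -> walk n p es q' -> cls n q = cls n q'.
Proof.
by elim: es p => [|e es IH] p /= => [<- <-//|[_ /IH h] [_ /h]].
Qed.

Lemma walk_rcons n p es e q : walk n p (rcons es e) q ->
  walk n p es (inl (tail e)) /\ cls n q = cls n (inl (head e)).
Proof.
by rewrite -cats1 => /walk_cat[z /= pz [ze <-]]; split=> //; exact: walk_end pz.
Qed.

(** An edge that becomes a loop in the coarser digraph starts and ends in the same class there, so
    the walk may skip it. *)
Lemma walk_filter n m p es q : (n <= m)%N -> walk m p es q ->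
  walk n p [seq e <- es | nonloop n e] q.
Proof.
move=> nm; elim: es p => [|e es IH] p /=; first exact: cls_mono.
move=> [/(cls_mono nm) pe /IH h]; case: ifPn => [_|/loop_cls ht]; first by split.
by apply: walk_start h; rewrite pe ht.
Qed.

Lemma walk_uniq n p es q : walk n p es q ->
  exists es', [/\ walk n p es' q, uniq es' & {subset es' <= es}].
Proof.
have [k] := ubnP (size es); elim: k es => // k IH es.
rewrite ltnS => sk pq; have [u|nu] := boolP (uniq es); first by exists es; split.
(* One of two occurrences of [e] can be cut out together with everything between them; induction on
   the length does the rest. *)
suff [a [e [b [c esE]]]] : exists a e b c, es = a ++ e :: b ++ e :: c.
  move: pq; rewrite esE => /walk_cat[z pz /= [ze /walk_cat[z' _ /= [_ hq]]]].
  case: (IH (a ++ e :: c)); first 1 last.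
  - by apply/walk_cat; exists z.
  - move=> es' [? ? sub]; exists es'; split=> // x /sub.
    by rewrite !(mem_cat, inE) => /or3P[->|->|->]; rewrite ?orbT.
  - by apply: leq_trans sk; rewrite esE !size_cat /= size_cat /= ltn_add2l; lia.
elim: es nu {sk pq} => //= x es IHes; rewrite negb_and negbK => /orP[|/IHes].
  by case/splitPr => b c; exists [::], x, b, c.
by move=> [a [e [b [c ->]]]]; exists (x :: a), e, b, c.
Qed.

(** * Separation and limits of classes *)

Hypothesis wc : weakly_connected G.

Lemma ball_cover v : exists n, gball n v.
Proof.
suff: forall u x, connected_avoiding set0 u x ->
    (exists n, gball n u) -> exists n, gball n x.
  by move=> /(_ _ _ (wc v0 v)); apply; exists 0%N.
move=> u x; elim=> [//|{}u y {}x e _ IH yx _ /IH[n bn]].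
by exists n.+1; right; exists y => //; exists e.
Qed.

Lemma ball_cover_fin (S : set (vertex G)) : finite_set S -> exists n, S `<=` gball n.
Proof.
move=> /finite_seqP[s ->]; elim: s => [|x s [n sn]]; first by exists 0%N.
have [m xm] := ball_cover x; exists (maxn n m) => y /=; rewrite inE.
case/orP => [/eqP->|/sn]; [move: xm|]; apply: ball_le; rewrite leq_max leqnn ?orbT //.
Qed.

(** A vertex is alone in its class once the ball contains it. Two ends that agree at every level
    have rays that no finite set separates, since each finite set lies in a ball. *)
Lemma cls_sep p q : p <> q -> exists n, cls n p <> cls n q.
Proof.
have vtx v p' : inl v <> p' -> exists n, cls n (inl v) <> cls n p'.
  have [n bv] := ball_cover v => vp; exists n => E; apply: vp.
  by apply/esym/(cls_ball bv); rewrite -E; exact: cls_refl.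
case: p => [v|w]; first exact: vtx.
case: q => [v /nesym/vtx[n /nesym ?]|w' ww']; first by exists n.
apply: contrapT => H; apply: ww'; congr inr.
have E n : cls n (inr w) = cls n (inr w') by apply: contrapT => ?; apply: H; exists n.
have [r wr] : exists r, end_rays w r.
  by case: (end_class w) => r ->; exists r; exact: ray_equiv_refl.
have [r' wr'] : exists r, end_rays w' r.
  by case: (end_class w') => r0 ->; exists r0; exact: ray_equiv_refl.
suff rr' : ray_equiv r r'.
  have EE : end_rays w = end_rays w'.
    apply/seteqP; split=> x hx.
    - by apply: end_closed wr' _; apply: ray_equiv_trans (ray_equiv_sym rr') (end_equiv wr hx).
    - by apply: end_closed wr _; apply: ray_equiv_trans rr' (end_equiv wr' hx).
  case: w w' EE {H E wr wr'} => a ha [b hb] /= ab; case: b / ab hb => hb.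
  by congr GraphEnd; exact: Prop_irrelevance.
move=> [S fS sep]; have [n Sn] := ball_cover_fin fS.
have [v wv] := cls_ex n (inr w); have wv' := wv; rewrite E in wv'.
case: wv wv' => [r1 wr1 r1v] [r2 wr2 r2v].
have /ray_equivP/(_ _ 0%N (ball_finite n))[a [a' [_ _ aa]]] := end_equiv wr wr1.
have /ray_equivP/(_ _ 0%N (ball_finite n))[b [b' [_ _ bb]]] := end_equiv wr2 wr'.
apply: (sep (ray_vertex r a) (ray_vertex r' b')); [by exists a|by exists b'|].
apply: (conn_sub Sn); apply: conn_trans aa _; apply: conn_trans bb.
have va : cpt n v (ray_vertex r1 a') by apply: r1v; exists a'.
have vb : cpt n v (ray_vertex r2 b) by apply: r2v; exists b.
exact: conn_trans (conn_sym va) vb.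
Qed.

(** On a path from [v0] to [v], the vertex after the last visit to the ball lies in the component of
    [v] and is adjacent to the ball. *)
Lemma cpt_sphere n v : ~ gball n v -> exists2 u, cpt n v u & gball n.+1 u.
Proof.
suff: forall a x, connected_avoiding set0 a x -> a = v0 ->
    ~ gball n x -> exists2 y, cpt n x y & gball n.+1 y by move=> /(_ _ _ (wc v0 v)); exact.
move=> a x; elim=> {a x v} [u _ ->|u v x e _ IH euv _ /IH {}IH nx].
  by move=> /(_ (@ball_le 0 n isT _ (erefl _))).
have [bv|nv] := pselect (gball n v).
  exists x; first exact: cpt_refl.
  by right; exists v => //; exists e.
have [y vy by_] := IH nv; exists y => //.
apply: conn_trans vy; apply: conn_step (conn_refl nx) (joins_sym euv) nv.
Qed.

(** Koenig's lemma: the sets [D n] of vertices of [C n] next to the ball are finite and non-empty,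
    each vertex of [D n.+1] has a neighbour in [D n], and a branch of the resulting tree is the
    ray. *)
Lemma ray_through (C : nat -> set (vertex G)) :
  (forall n, exists2 v, ~ gball n v & C n = cpt n v) ->
  (forall n, C n.+1 `<=` C n) ->
  exists r : ray G, forall n, C n (ray_vertex r n).
Proof.
move=> hC dC.
pose D n := C n `&` gball n.+1.
have D0 n : D n !=set0.
  have [v nv CE] := hC n; have [u vu bu] := cpt_sphere nv.
  by exists u; split=> //; rewrite CE.
have nb n v : C n v -> ~ gball n v.
  by have [u _ ->] := hC n; move=> /conn_avoidr.
have parent n v : exists u, D n.+1 v -> D n u /\ exists e, joins e u v.
  have [[Cv bv]|?] := pselect (D n.+1 v); last by exists v.
  case: bv => [/(nb _ _ Cv)//|[u bu [e euv]]].
  exists u => _; split; last by exists e.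
  split=> //; have := dC _ _ Cv; have [y _ ->] := hC n => yv.
  apply: (conn_step yv (joins_sym euv)) => bu'.
  by apply: (nb _ _ Cv); right; exists u => //; exists e.
have {parent} [par parP] := choice (fun nv : nat * vertex G => parent nv.1 nv.2).
have [top topP] := choice D0.
(* [y N d] is the ancestor of [top N] at level [N - d]; counting downwards makes the recursion
   structural. *)
pose y := fix y N d := if d is d'.+1 then par ((N - d)%N, y N d') else top N.
have yD N d : (d <= N)%N -> D (N - d)%N (y N d).
  elim: d => [|d IH] dN /=; first by rewrite subn0; exact: topP.
  have := @parP ((N - d.+1)%N, y N d) => /=.
  by rewrite -subSn// subSS => /(_ (IH (ltnW dN)))[].
have [U [UU Uoo]] := ultraFilterLemma eventually_filter.
(* Level [k] is finite, so some vertex [x k] is the ancestor at this level for almost all [N] in the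
   sense of [U]. *)
have xP k : exists x, U [set N | (k <= N)%N /\ y N (N - k)%N = x].
  have fD : finite_set (D k).
    by apply: sub_finite_set (ball_finite k.+1) => z [].
  case/finite_seqP: fD => l lE.
  have Uk : U [set N | (k <= N)%N] by apply: Uoo; exact: nbhs_infty_ge.
  have [|x Ux] := @ultra_fin U _ l (fun N => y N (N - k)%N) UU.
    apply: filterS Uk => N /= kN.
    have := @yD N (N - k)%N (leq_subr _ _); rewrite subKn//.
    by rewrite lE.
  by exists x; exact: filterI.
have [x {}xP] := choice xP.
have xD k : D k (x k).
  by have [N [kN <-]] := filter_ex (xP k); rewrite -{1}(subKn kN); apply: yD; exact: leq_subr.
have xE k : exists e, joins e (x k) (x k.+1).
  have [N [[kN yk] [kN' yk']]] := filter_ex (filterI (xP k) (xP k.+1)).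
  have := @parP (k, x k.+1) (xD k.+1) => -[_].
  suff -> : par (k, x k.+1) = x k by [].
  by rewrite -yk -yk' -(subnSK kN') /= subnSK// subKn.
have [e eP] := choice xE.
(* For [i < j], [x i] lies in the ball of radius [i + 1 <= j], which [x j] avoids. *)
have xI : injective x.
  suff lt i j : (i < j)%N -> x i <> x j.
    by move=> i j; case: (ltngtP i j) => // /lt h /esym // /esym /h.
  move=> ij E; apply: (nb j (x j)); first by case: (xD j).
  by rewrite -E; apply: (ball_le ij); case: (xD i).
by exists (Ray xI eP) => n; case: (xD n).
Qed.

(** Completeness of the inverse system: a class that meets its ball is a single vertex, which is
    then the limit; otherwise the classes are a decreasing sequence of components, and a ray through
    them gives an end. *)
Lemma limit_node (u : nat -> node) :
  (forall n m, (n <= m)%N -> cls n (u m) = cls n (u n)) ->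
  exists p, forall n, cls n p = cls n (u n).
Proof.
move=> uP.
have [[n [v [bv vn]]]|H] := pselect (exists n v, gball n v /\ cls n (u n) v).
  exists (u n) => m; case/orP: (leq_total n m) => nm; last first.
    by rewrite (uP _ _ nm).
  rewrite (cls_ball bv vn); congr cls; apply/esym/(cls_ball bv).
  by rewrite (uP _ _ nm).
have nb n v : cls n (u n) v -> ~ gball n v by move=> ? ?; apply: H; exists n, v.
have [|n|r rP] := @ray_through (fun n => cls n (u n)).
- move=> n; have [v vn] := cls_ex n (u n).
  by exists v; [exact: nb vn|exact: (cls_notballP (nb _ _ vn) vn)].
- by rewrite -(uP n n.+1)//; exact: cls_le.
exists (inr (@GraphEnd G [set r' | ray_equiv r r'] (ex_intro _ r erefl))) => n.
have [v vn] := cls_ex n (u n); have nv := nb _ _ vn.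
have uE := cls_notballP nv vn.
apply: (@cls_common n _ _ v) => //=.
exists (ray_drop r n); first exact: ray_drop_equiv.
move=> _ [k _ <-]; rewrite -uE -(uP n (n + k)%N) ?leq_addr//=.
by apply: (@cls_le n (n + k)) (rP _); exact: leq_addr.
Qed.

End Exhaustion.
Arguments cls {G} v0 n p : simpl never.

(** * Ordering a countable set by intervals *)

Section Intervals.
Context {R : realType} {T : choiceType}.
Local Open Scope ring_scope.

Let weight k : R := 2^-1 ^+ k.+1.

Lemma sum_weight_le1 (l : seq nat) : uniq l -> \sum_(k <- l) weight k <= 1.
Proof.
move=> ul.
have w0 k : 0 <= weight k by rewrite exprn_ge0// invr_ge0.
(* All numbers below [N] together weigh [1 - 2^-N], and those in [l] are among them. *)
pose N := (\max_(k <- l) k).+1.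
have lN : perm_eq l [seq k <- iota 0 N | k \in l].
  apply: uniq_perm => // [|k]; first by rewrite filter_uniq// iota_uniq.
  rewrite mem_filter mem_iota /= add0n; case: (boolP (k \in l)) => //= kl.
  by rewrite ltnS (big_rem k)//= leq_max leqnn.
rewrite (perm_big _ lN) big_filter /= big_mkcond /=.
have le1 : \sum_(k <- iota 0 N) (if k \in l then weight k else 0) <=
    \sum_(k <- iota 0 N) weight k.
  by apply: ler_sum => k _; case: ifP.
apply: (le_trans le1).
suff -> : \sum_(k <- iota 0 N) weight k = 1 - 2^-1 ^+ N.
  by rewrite gerBl exprn_ge0// invr_ge0.
elim: N {lN le1} => [|N IH]; first by rewrite big_nil expr0 subrr.
rewrite -[in iota _ _]addn1 iotaD big_cat /= IH big_seq1 add0n /weight.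
by rewrite exprS; set z := _ ^+ N; lra.
Qed.

(* The interval of [e] starts at the sum of the weights of all elements below
   [e]. *)
Lemma order_intervals (E : set T) (prec : T -> T -> Prop) (c : T -> nat) :
  (forall e f, E e -> E f -> c e = c f -> e = f) ->
  (forall e, E e -> ~ prec e e) ->
  (forall e f g, E e -> E f -> E g -> prec e f -> prec f g -> prec e g) ->
  exists a b : T -> R,
    (forall e, E e -> [/\ 0 <= a e, a e < b e & b e <= 1]) /\
    forall e f, E e -> E f -> prec e f -> b e <= a f.
Proof.
move=> cI irr tr.
pose sums (D : set T) : set R := [set x | exists l : seq T,
  [/\ uniq l, forall e, e \in l -> E e /\ D e & x = \sum_(e <- l) weight (c e)]].
pose a e := sup (sums (fun f => prec f e)).
have s0 D : sums D 0 by exists [::]; split=> //; rewrite big_nil.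
have s1 D : ubound (sums D) 1.
  move=> _ [l [ul lE ->]]; rewrite -(big_map c xpredT weight).
  apply: sum_weight_le1; rewrite map_inj_in_uniq// => e f /lE[Ee _] /lE[Ef _].
  exact: cI.
have hs D : has_sup (sums D) by split; [exists 0|exists 1].
(* Adjoining [e] to [D] raises the total weight by at least the weight of [e]. This bounds the end
   of the interval of [e] by 1 and by the start of every later interval. *)
have step D e x : E e -> ~ D e -> (forall y, sums (D `|` [set e]) y -> y <= x) ->
    sup (sums D) + weight (c e) <= x.
  move=> Ee nD xub; rewrite -lerBrDr; apply: ge_sup; first by exists 0.
  move=> _ [l [ul lE ->]]; rewrite lerBrDr; apply: xub.
  exists (e :: l); split; last by rewrite big_cons addrC.
  - by rewrite /= ul andbT; apply/negP => /lE[].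
  - by move=> f; rewrite inE => /orP[/eqP->|/lE[? ?]]; split=> //; [right|left].
exists a, (fun e => a e + weight (c e)); split.
  move=> e Ee; split.
  - by apply: sup_upper_bound; [exact: hs|exact: s0].
  - by rewrite ltrDl exprn_gt0// invr_gt0.
  - apply: step => //; first exact: irr.
    exact: s1.
move=> e f Ee Ef ef; apply: step => //; first exact: irr.
move=> _ [l [ul lE ->]]; apply: sup_upper_bound; first exact: hs.
exists l; split=> // g /lE[Eg [ge|->//]]; split=> //; exact: tr ge ef.
Qed.

End Intervals.

(** * Words over a finite alphabet *)

Section Words.
Context {T : eqType}.
Implicit Types (l s : seq T).

Fixpoint words l k : seq (seq T) :=
  if k is k'.+1 then [::] :: [seq x :: s | x <- l, s <- words l k'] else [:: [::]].

Lemma mem_words l k s : {subset s <= l} -> (size s <= k)%N -> s \in words l k.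
Proof.
elim: k s => [|k IH] [|x s] //= sl sk; rewrite inE; apply/orP; right.
apply: allpairs_f; first by apply: sl; rewrite mem_head.
by apply: IH => // y ys; apply: sl; rewrite inE ys orbT.
Qed.

(** The order along a trail is expressed by [subseq], which is compatible with [filter]; positions
    then give irreflexivity, transitivity and totality. *)
Lemma subseq2P s x y : uniq s ->
  subseq [:: x; y] s = (y \in s) && (index x s < index y s)%N.
Proof.
elim: s => //= z s IH /andP[zs us]; rewrite (eq_sym z x) (eq_sym z y) inE.
have [_|xz] := eqVneq x z.
  rewrite sub1seq; have [->|yz] := eqVneq y z; first by rewrite (negbTE zs).
  by rewrite /= andbT.
have [->|yz] := eqVneq y z; last by rewrite IH //= ltnS.
rewrite ltn0 andbF; apply/negP => /mem_subseq/(_ z).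
by rewrite !inE eqxx orbT (negbTE zs) => /(_ isT).
Qed.

End Words.

(** * Compatible trails *)

Section Sides.
Context {G : digraph} (v0 : vertex G).
Hypothesis (lf : locally_finite G) (wc : weakly_connected G).
Implicit Types (u v : vertex G) (n m : nat) (X : set (vertex G)) (p q : @node G).

Definition side X p : Prop :=
  match p with inl v => X v | inr w => end_has_ray_in w X end.

(* [X] is a union of classes, that is, no cut edge of [X] is contracted. *)
Definition saturated n X :=
  forall u v, cls v0 n (inl u) = cls v0 n (inl v) -> X u -> X v.

Lemma saturatedC n X : saturated n X -> saturated n (~` X).
Proof. by move=> sX u v uv nXu Xv; apply: nXu; apply: sX Xv. Qed.

(** A saturated set contains a component entirely or misses it, and every ray of an end has vertices
    in the component that is the class of the end. *)
Lemma side_cls n X p v : saturated n X -> cls v0 n p v -> (side X p <-> X v).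
Proof.
move=> sX pv; case: p pv => [u /cls_eq uv|w wv] /=.
  by split; apply: sX; rewrite uv.
have [nv wE] := cls_inr lf wv.
have cvX u u' : cpt v0 n u u' -> X u -> X u'.
  move=> uu; apply: sX; rewrite (cls_inl uu) (cpt_eq uu).
  by rewrite (cls_inl (conn_sym uu)).
case: (wv) => r wr rv; split=> [[r' wr' r'X]|Xv].
  have /ray_equivP/(_ _ 0%N (ball_finite v0 lf n))[k [k' [_ _ kk]]] := end_equiv wr wr'.
  apply: (@cvX (ray_vertex r' k')); last by apply: r'X; exists k'.
  have /rv/= vk : ray_vertices r (ray_vertex r k) by exists k.
  exact: conn_sym (conn_trans vk kk).
by exists r => // x /rv/cvX; apply.
Qed.

Lemma side_cls_eq n X p q : saturated n X -> cls v0 n p = cls v0 n q ->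
  side X p -> side X q.
Proof.
move=> sX pq; have [v pv] := cls_ex v0 lf n p.
by move=> /(side_cls sX pv) Xv; apply/(side_cls (v := v) sX) => //; rewrite -pq.
Qed.

Lemma sideC n X p : saturated n X -> side (~` X) p <-> ~ side X p.
Proof.
move=> sX; have [v pv] := cls_ex v0 lf n p.
by split=> [/(side_cls (saturatedC sX) pv) nX /(side_cls sX pv)//|nX];
  apply/(side_cls (saturatedC sX) pv) => /(side_cls sX pv).
Qed.

Lemma nonloop_saturated n X :
  (forall e, edges_between X (~` X) e -> nonloop v0 n e) -> saturated n X.
Proof.
move=> H u v uv; have : cls v0 n (inl v) u by rewrite -uv; exact: cls_refl.
case=> [->//|vu Xu]; elim: vu Xu => // {u v uv} u y z e uy IH eyz nz Xz.
apply: IH; apply: contrapT => nXy.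
have : nonloop v0 n e.
  by apply: H; case: eyz => -[ty hz]; [right|left]; rewrite /edges_from /= ty hz.
move: (conn_avoidr uy) nz; case: eyz => -[<- <-] nt nh; by move=> /(nonloopP v0 lf)[].
Qed.

Lemma saturated_nonloop n X e : saturated n X -> edges_between X (~` X) e -> nonloop v0 n e.
Proof.
move=> sX H; apply: contrapT => /negP/loop_cls E.
by case: H => -[a b]; [exact: b (sX _ _ E a)|exact: a (sX _ _ (esym E) b)].
Qed.

Lemma saturated_finite n X : saturated n X -> finite_set (edges_between X (~` X)).
Proof.
by move=> sX; apply: sub_finite_set (nonloop_finite v0 lf n) => e /(saturated_nonloop sX).
Qed.

(** With [saturated_finite], this identifies the finite cuts of [G] with the cuts of the contracted
    digraphs: some ball contains the tails of all cut edges, so none of these is contracted. *)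
Lemma finite_saturated X : finite_set (edges_between X (~` X)) ->
  exists n, saturated n X.
Proof.
move=> fX; have [|n nX] := @ball_cover_fin _ v0 wc (@tail G @` edges_between X (~` X)).
  exact: finite_image.
by exists n; apply: nonloop_saturated => e eX; apply/(nonloopP v0 lf); left; apply: nX; exists e.
Qed.

Lemma cutC X Y : is_cut X Y -> Y = ~` X.
Proof.
move=> [_ _ XY XYT]; apply/seteqP; split=> v.
  by move=> Yv Xv; have : (X `&` Y) v by []; rewrite XY.
by move=> nX; have [|//] : (X `|` Y) v by rewrite XYT.
Qed.

(** Telescoping along the walk: exits from [X] and entries into [X] alternate, so their numbers
    differ only by the sides of [p] and [q]. *)
Lemma walk_count n X p es q : saturated n X -> walk v0 n p es q ->
  (count [pred e | `[< edges_from X (~` X) e >]] es + `[< side X q >] =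
   count [pred e | `[< edges_from (~` X) X e >]] es + `[< side X p >])%N.
Proof.
move=> sX; elim: es p => [|e es IH] p /=.
  move=> pq; congr (_ + nat_of_bool _)%N; apply/asbool_equiv_eq.
  by split; [exact: (side_cls_eq sX (esym pq))|exact: (side_cls_eq sX pq)].
move=> [pe /IH]; rewrite -!addnA => ->; rewrite !addnA.
have -> : `[< side X p >] = `[< X (tail e) >].
  by apply/asbool_equiv_eq; split; [exact: (side_cls_eq (q := inl (tail e)) sX pe)
    |exact: (side_cls_eq (p := inl (tail e)) sX (esym pe))].
rewrite /edges_from /=.
rewrite !asbool_and !asbool_neg.
by case: asboolP => _; case: asboolP => _ /=; lia.
Qed.

Context (F : set (edge G)) (s t : @node G).

(** A point of the inverse limit of the sets of trails. [coh_filter] with [m = n] also says that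
    [P n] contains no contracted edge. *)
Record coherent (P : nat -> seq (edge G)) : Prop := Coherent {
  coh_walk : forall n, walk v0 n s (P n) t;
  coh_uniq : forall n, uniq (P n);
  coh_sub : forall n e, e \in P n -> F e;
  coh_filter : forall n m, (n <= m)%N -> [seq e <- P m | nonloop v0 n e] = P n
}.

Hypothesis cutF : forall X, finite_set (edges_between X (~` X)) ->
  side X s -> side (~` X) t -> F `&` edges_from X (~` X) !=set0.

(** If [t] is not reachable along [F] in the contracted digraph, the vertices that are reached form
    one side of a finite cut, and an edge of [F] that leaves this side reaches a further vertex. *)
Lemma trail_ex n : exists es,
  [/\ walk v0 n s es t, uniq es & forall e, e \in es -> F e].
Proof.
suff [es st esF] : exists2 es, walk v0 n s es t & forall e, e \in es -> F e.
  have [es' [? ? sub]] := walk_uniq st; exists es'; split=> // e /sub; exact: esF.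
apply: contrapT => H.
pose X := [set v | exists2 es, walk v0 n s es (inl v) & forall e, e \in es -> F e].
have sX : saturated n X.
  by move=> u v uv [es su esF]; exists es => //; exact: walk_end su.
have sidesX : side X s.
  have [v sv] := cls_ex v0 lf n s; apply/(side_cls sX sv).
  by exists [::] => //=; exact: cls_eq.
have sidetX : side (~` X) t.
  have [v tv] := cls_ex v0 lf n t; apply/(side_cls (saturatedC sX) tv).
  move=> [es sv esF]; apply: H; exists es => //.
  by apply: walk_end sv; apply/esym/cls_eq.
have [e [Fe [[es sv esF] nX]]] := cutF (saturated_finite sX) sidesX sidetX.
apply: nX; exists (rcons es e) => [|f]; last first.
  by rewrite mem_rcons inE => /orP[/eqP->//|/esF].
by rewrite -cats1; apply/walk_cat; exists (inl (tail e)).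
Qed.

Lemma coherent_ex : exists P, coherent P.
Proof.
have [Q QP] := choice trail_ex.
have [U [UU Uoo]] := ultraFilterLemma eventually_filter.
(* Restricted to level [m], each trail is a word without repetition over finitely many edges, so a
   single restriction [r] occurs for almost all [n]. *)
have PP m : exists r, U [set n | (m <= n)%N /\ [seq e <- Q n | nonloop v0 m e] = r].
  have /finite_seqP[l lE] := nonloop_finite v0 lf m.
  have [|r Ur] := @ultra_fin U _ (words l (size l))
      (fun n => [seq e <- Q n | nonloop v0 m e]) UU.
    apply: filterS (filterT (F := U)) => n _ /=.
    have sub : {subset [seq e <- Q n | nonloop v0 m e] <= l}.
      move=> e; rewrite mem_filter => /andP[te _].
      by have : [set e | nonloop v0 m e] e by []; rewrite lE.
    apply: mem_words => //; apply: uniq_leq_size => //.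
    by apply: filter_uniq; case: (QP n).
  exists r; apply: filterI => //; apply: Uoo; exact: nbhs_infty_ge.
have [P {}PP] := choice PP; exists P; split=> n.
- have [m [nm <-]] := filter_ex (PP n); case: (QP m) => st _ _; exact: walk_filter st.
- have [m [nm <-]] := filter_ex (PP n); case: (QP m) => _ um _; exact: filter_uniq.
- move=> e; have [m [nm <-]] := filter_ex (PP n).
  by rewrite mem_filter => /andP[_]; case: (QP m) => _ _; apply.
(* Both restrictions come from a single trail [Q k], and every edge kept at level [n] is kept at
   level [m]. *)
- move=> m nm; have [k [[_ <-] [_ <-]]] := filter_ex (filterI (PP m) (PP n)).
  rewrite -filter_predI; apply: eq_filter => e /=.
  by case: (boolP (nonloop v0 n e)) => //= /(nonloop_mono lf nm) ->.
Qed.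

End Sides.

(** * The linear order on the union of the trails *)

Section Limit.
Context {G : digraph} {v0 : vertex G}.
Hypothesis (lf : locally_finite G) (wc : weakly_connected G).
Context {F : set (edge G)} {s t : @node G} (P : nat -> seq (edge G)).
Hypothesis cP : coherent v0 F s t P.
Implicit Types (e f g : edge G) (n m : nat).

Definition limit_edge e := exists n, e \in P n.

Definition prec e f := exists n, subseq [:: e; f] (P n).

Lemma coh_nonloop n e : e \in P n -> nonloop v0 n e.
Proof. by rewrite -(coh_filter cP (leqnn n)) mem_filter => /andP[]. Qed.

Lemma coh_mem n e : limit_edge e -> nonloop v0 n e -> e \in P n.
Proof.
move=> [m em] te; rewrite -(coh_filter cP (leq_maxl n m)) mem_filter te /=.
by move: em; rewrite -(coh_filter cP (leq_maxr n m)) mem_filter => /andP[].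
Qed.

Lemma coh_le n m e : (n <= m)%N -> e \in P n -> e \in P m.
Proof. by move=> nm; rewrite -(coh_filter cP nm) mem_filter => /andP[]. Qed.

Lemma limit_edgeF e : limit_edge e -> F e.
Proof. by move=> [n]; exact: (coh_sub cP). Qed.

Lemma limit_edge_mem e n : limit_edge e -> exists2 m, (n <= m)%N & e \in P m.
Proof.
by move=> [m em]; exists (maxn n m); [exact: leq_maxl|exact: coh_le (leq_maxr _ _) em].
Qed.

(** Restricting a trail keeps the order of the remaining edges, so all levels that contain both
    edges agree on their order. *)
Lemma prec_at n e f : prec e f -> e \in P n -> f \in P n -> subseq [:: e; f] (P n).
Proof.
move=> [m]; rewrite -(coh_filter cP (leq_maxl m n)) subseq_filter => /andP[_ sub].
move=> /coh_nonloop te /coh_nonloop tf.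
by rewrite -(coh_filter cP (leq_maxr m n)) subseq_filter /= te tf.
Qed.

Lemma prec_irr e : ~ prec e e.
Proof. by move=> [n]; rewrite subseq2P ?ltnn ?andbF//; exact: (coh_uniq cP). Qed.

Lemma prec_trans e f g : limit_edge e -> limit_edge f -> limit_edge g ->
  prec e f -> prec f g -> prec e g.
Proof.
move=> /(limit_edge_mem 0)[n _ en] /(limit_edge_mem n)[m nm fm].
move=> /(limit_edge_mem m)[k mk gk]; have {}fk := coh_le mk fm.
have {}ek := coh_le (leq_trans nm mk) en.
move=> /prec_at/(_ ek fk) ef /prec_at/(_ fk gk) fg; exists k; move: ef fg.
rewrite !subseq2P ?(coh_uniq cP)// => /andP[_ ef] /andP[-> fg].
exact: ltn_trans fg.
Qed.

Lemma prec_total e f : limit_edge e -> limit_edge f -> e <> f -> prec e f \/ prec f e.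
Proof.
move=> /(limit_edge_mem 0)[n _ en] /(limit_edge_mem n)[m nm fm] nef.
have {}en := coh_le nm en.
have [ef|fe|E] := ltngtP (index e (P m)) (index f (P m)).
- by left; exists m; rewrite subseq2P ?(coh_uniq cP)// fm ef.
- by right; exists m; rewrite subseq2P ?(coh_uniq cP)// en fe.
- by exfalso; apply: nef; rewrite -(nth_index e en) E nth_index.
Qed.

(** The union is countable: an edge is determined by a level at which it occurs and its position in
    the trail there. *)
Lemma limit_edge_code : exists c : edge G -> nat,
  forall e f, limit_edge e -> limit_edge f -> c e = c f -> e = f.
Proof.
have lev e : exists n, limit_edge e -> e \in P n.
  by have [[n en]|?] := pselect (limit_edge e); [exists n|exists 0%N].
have [l lP] := choice lev.
exists (fun e => choice.pickle (l e, index e (P (l e)))) => e f /lP el /lP fl.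
move=> /(pcan_inj (@choice.pickleK _)) [lef].
by rewrite -lef in fl *; move=> E; rewrite -(nth_index e el) E nth_index.
Qed.

Lemma edge_intervals (R : realType) : exists a b : edge G -> R,
  (forall e, limit_edge e -> [/\ 0 <= a e, a e < b e & b e <= 1])%R /\
  forall e f, limit_edge e -> limit_edge f -> prec e f -> (b e <= a f)%R.
Proof.
have [c cI] := limit_edge_code; apply: (order_intervals cI); first by move=> e _; exact: prec_irr.
exact: prec_trans.
Qed.

Lemma coh_nonempty : s <> t -> exists N, forall n, (N <= n)%N -> P n != [::].
Proof.
move=> /(cls_sep v0 lf wc)[N sep]; exists N => n Nn; apply/eqP => E; apply: sep.
by have := coh_walk cP n; rewrite E /= => /(cls_mono lf Nn).
Qed.

End Limit.

(** * Crossing a finite cut *)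

Section RealCrossing.
Context {R : realType}.
Local Open Scope ring_scope.

Lemma nbhs_itv (x : R) (A : set R) : nbhs x A <->
  exists2 d, 0 < d & forall y, x - d < y < x + d -> A y.
Proof.
split=> [/nbhs_ballP[d /= d0 dA]|[d d0 dA]].
  exists d => // y /andP[y1 y2]; apply: dA; rewrite /ball /= ltr_norml; lra.
apply/nbhs_ballP; exists d => //= y; rewrite /ball /= ltr_norml => /andP[y1 y2].
by apply: dA; lra.
Qed.

Definition itv_continuous (g : R -> R) := forall x eps, 0 <= x <= 1 -> 0 < eps ->
  exists2 d, 0 < d & forall y, 0 <= y <= 1 -> x - d < y < x + d ->
    g x - eps < g y < g x + eps.

(** At the infimum of the times with [g >= 1/2], a value below 1/2 would persist to the right, and a
    value above 1/2 would already occur to the left. *)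
Lemma first_hit (g : R -> R) (x1 : R) : itv_continuous g -> 0 <= x1 <= 1 ->
  g 0 = 0 -> g x1 = 1 ->
  exists x, [/\ 0 < x <= 1, g x = 2^-1 & forall y, 0 <= y -> y < x -> g y < 2^-1].
Proof.
move=> gc x11 g0 g1; pose A := [set x | 0 <= x <= 1 /\ 2^-1 <= g x].
have A1 : A x1 by split=> //; rewrite g1; lra.
have hA : has_inf A by split; [exists x1|exists 0 => y [/andP[]]].
pose x := inf A.
have x0 : 0 <= x by apply: lb_le_inf; [exists x1|move=> y [/andP[]]].
have xx1 : x <= x1 by apply: ge_inf => //; case: hA.
have below y : 0 <= y -> y < x -> g y < 2^-1.
  move=> y0 yx; rewrite ltNge; apply/negP => gy.
  suff : x <= y by lra.
  by apply: ge_inf; [case: hA|split=> //; lra].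
have x01 : 0 <= x <= 1 by lra.
have gx : 2^-1 <= g x.
  rewrite leNgt; apply/negP => gx.
  have [|d d0 H] := gc x (2^-1 - g x) x01; first by lra.
  have [y [y01 gy] yd] := inf_adherent d0 hA.
  have xy : x <= y by apply: ge_inf; [case: hA|].
  have := H y y01; lra.
have {}x0 : 0 < x.
  by rewrite lt_neqAle x0 andbT; apply/eqP => E; move: gx; rewrite -E g0; lra.
exists x; split=> //; first lra.
apply/eqP; rewrite eq_le gx andbT leNgt; apply/negP => gx'.
have [|d d0 H] := gc x (g x - 2^-1) x01; first by lra.
(* [x - d / 2] may be negative; then time 0 is close enough to [x]. *)
have [xd|xd] := leP x (d / 2).
  by have := H 0; have := below 0; lra.
by have := H (x - d / 2); have := below (x - d / 2); lra.
Qed.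

(** Reversing both time and height reduces this to [first_hit]. *)
Lemma last_hit (g : R -> R) (x0 : R) : itv_continuous g -> 0 <= x0 <= 1 ->
  g 1 = 1 -> g x0 = 0 ->
  exists x, [/\ 0 <= x < 1, g x = 2^-1 & forall y, y <= 1 -> x < y -> 2^-1 < g y].
Proof.
move=> gc x01 g1 g0.
have [| | | |x [x1 gx H]] := @first_hit (fun x => 1 - g (1 - x)) (1 - x0).
- move=> x eps x1 eps0; have [|d d0 H] := gc (1 - x) eps _ eps0; first by lra.
  by exists d => // y y1 yx; have := H (1 - y); lra.
- by lra.
- by rewrite subr0 g1 subrr.
- by rewrite subKr g0 subr0.
exists (1 - x); split; [lra|lra|] => y y1 xy.
by have := H (1 - y); rewrite /= subKr; lra.
Qed.

End RealCrossing.

Section Space.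
Context {R : realType} {G : digraph}.
Implicit Types (p q : @node G) (e : edge G) (v : vertex G).
Local Open Scope ring_scope.

Definition pt p : fpoint R G := match p with inl v => Vtx v | inr w => End w end.

Lemma vertices_and_endsP (x : fpoint R G) : vertices_and_ends x -> exists p, x = pt p.
Proof. by case=> -[a _ <-]; [exists (inl a)|exists (inr a)]. Qed.

Lemma pt_inner p e z : pt p <> Inner e z.
Proof. by case: p. Qed.

Lemma node_vertex p : inhabited (vertex G).
Proof. by case: p => [//|w]; case: (end_class w) => r _; split; exact: ray_vertex r 0%N. Qed.

Lemma basic_nbhd_self (x : fpoint R G) N : basic_nbhd x N -> N x.
Proof.
case: x => [v|e z|w] /=; [by move=> [d _ ->]| |by move=> [S [C [d [_ _ ? _ ->]]]]].
by move=> [d /andP[d0 _] ->] /=; rewrite subrr normr0.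
Qed.

Lemma nbhs_basic (x : fpoint R G) N : basic_nbhd x N -> nbhs x N.
Proof.
by move=> xN; apply: open_nbhs_nbhs; split; [exact: basic_nbhd_open xN|exact: basic_nbhd_self].
Qed.

Lemma basic_nbhs (x : fpoint R G) A : nbhs x A -> exists2 N, basic_nbhd x N & N `<=` A.
Proof.
rewrite nbhsE => -[U [oU Ux] UA]; have oU' : fopen U by [].
by have [N xN NU] := oU' _ Ux; exists N => //; apply: subset_trans UA.
Qed.

Lemma inner_edge_nbhs e z : nbhs (Inner e z) (@inner_edge R G e).
Proof.
have b : basic_nbhd (Inner e z) (@inner_nbhd R G e (val z) 1).
  by exists 1 => //; rewrite ltr01 lexx.
by apply: filterS (nbhs_basic b) => -[v|f y|w] //= [-> _]; exists y.
Qed.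

Lemma edge_point_inner e f (a : R) z : edge_point e a = Inner f z -> e = f /\ a = val z.
Proof. by rewrite /edge_point; case: insubP => // u _ <- [-> ->]. Qed.

Lemma edge_point_val e (z : {x : R | 0 < x < 1}) : edge_point e (val z) = Inner e z.
Proof. by rewrite /edge_point valK. Qed.

Lemma edge_ltP e (y z : {x : R | 0 < x < 1}) :
  edge_lt e (Inner e y) (Inner e z) <-> val y < val z.
Proof.
split=> [[a [b [_ _ /edge_point_inner[_ ->] /edge_point_inner[_ ->]]]] //|yz].
exists (val y), (val z); rewrite !edge_point_val; split=> //.
- by have := valP y; lra.
- by have := valP z; lra.
Qed.

Lemma within_itv (sigma : R -> fpoint R G) (x : R) (A : set (fpoint R G)) :
  {within `[0, 1], continuous sigma} -> 0 <= x <= 1 -> nbhs (sigma x) A ->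
  exists2 d, 0 < d & forall y, 0 <= y <= 1 -> x - d < y < x + d -> A (sigma y).
Proof.
move=> /subspace_continuousP H x01 /(H x); rewrite /= in_itv /= x01 => /(_ isT).
rewrite /within /= => /nbhs_itv[d d0 dA]; exists d => // y y01 yd.
by apply: (dA y yd); rewrite /= in_itv.
Qed.

(** * The height function of a finite cut *)

Section Height.
Context {v0 : vertex G} (lf : locally_finite G) (wc : weakly_connected G).
Context {n : nat} {X : set (vertex G)} (sX : saturated v0 n X).

Definition level (X : set (vertex G)) p : R := if `[< side X p >] then 0 else 1.

Definition height (X : set (vertex G)) x : R :=
  match x with
  | Vtx v => level X (inl v)
  | Inner e z => (1 - val z) * level X (inl (tail e)) + val z * level X (inl (head e))
  | End w => level X (inr w)
  end.

Lemma levelP Y p : (side Y p /\ level Y p = 0) \/ (~ side Y p /\ level Y p = 1).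
Proof. by rewrite /level; case: asboolP => ?; [left|right]. Qed.

Lemma height_pt Y p : height Y (pt p) = level Y p.
Proof. by case: p. Qed.

Lemma level_cls p v : cls v0 n p v -> level X (inl v) = level X p.
Proof.
move=> pv; rewrite /level; congr (if _ then _ else _).
by apply/asbool_equiv_eq; have [a b] := side_cls lf sX pv; split.
Qed.

Lemma height_close e v (z : {x : R | 0 < x < 1}) (eps : R) : close_to e v (val z) eps ->
  `|height X (Inner e z) - level X (inl v)| < eps.
Proof.
have := valP z; rewrite ltr_norml /= => z01.
by case=> -[<- zeps]; case: (levelP X (inl (tail e))) => -[_ ->];
  case: (levelP X (inl (head e))) => -[_ ->]; lra.
Qed.

Lemma height_continuous : continuous (height X).
Proof.
move=> x; have FF : Filter (nbhs x) by exact: nbhs_filter.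
apply/cvgrPdist_lt => eps eps0.
pose d := Num.min eps 1.
have d01 : 0 < d <= 1 by rewrite lt_min eps0 ltr01 ge_min lexx orbT.
have deps : d <= eps by rewrite ge_min lexx.
suff [N xN NP] : exists2 N, basic_nbhd x N &
    forall y, N y -> `|height X y - height X x| < d.
  by apply: filterS (nbhs_basic xN) => y /NP; rewrite distrC => /lt_le_trans; apply.
have d0 : 0 < d by case/andP: d01.
case: x {FF} => [v|e z|w].
- exists (vertex_nbhd v d); first by exists d.
  by move=> [u|e y|w] //= => [->|/height_close//]; rewrite subrr normr0.
- exists (inner_nbhd e (val z) d); first by exists d.
  move=> [u|f y|w] //= [->]; rewrite !ltr_norml => /andP[y1 y2].
  by case: (levelP X (inl (tail e))) => -[_ ->];
    case: (levelP X (inl (head e))) => -[_ ->]; lra.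
(* As [X] is saturated at level [n], the height is constant on the component of [G - gball n] that
   holds the end, and changes by less than [d] on partial edges of length [d]. *)
- have [v wv] := cls_ex v0 lf n (inr w); have [nv wE] := cls_inr lf wv.
  have lw u : cpt v0 n v u -> level X (inl u) = level X (inr w).
    by move=> vu; apply: level_cls; rewrite wE.
  exists (end_nbhd (gball v0 n) (cpt v0 n v) d).
    exists (gball v0 n), (cpt v0 n v), d; split=> //; first exact: ball_finite.
    exact: cpt_component.
  move=> [u /lw|e y|w' ww'] /=; first by move=> ->; rewrite subrr normr0.
    case=> [[/lw -> /lw ->]|[u [a [/lw <- _ _ /height_close//]]]].
    by rewrite (_ : _ - _ = 0) ?normr0//; ring.
  rewrite /= -(lw v (cpt_refl nv)); rewrite (@level_cls (inr w') v) ?subrr ?normr0//.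
Qed.

Lemma height_itv_continuous (sigma : R -> fpoint R G) :
  {within `[0, 1], continuous sigma} -> itv_continuous (height X \o sigma).
Proof.
move=> sc x eps x01 eps0.
have /cvgrPdist_lt/(_ eps eps0)/(within_itv sc x01)[d d0 H] := @height_continuous (sigma x).
exists d => // y y01 yd; have := H y y01 yd; rewrite /= ltr_norml; lra.
Qed.

Context {W : set (fpoint R G)} {lt : fpoint R G -> fpoint R G -> Prop}.
Context {sigma : R -> fpoint R G} (wit : is_witness W lt sigma) (dir : directed W lt).

(* Near the time [x] a directed walk runs along the edge through [sigma x] from
   tail to head, so the height increases there only on an edge that leaves [X]. *)
Lemma crossing_edge (x : R) : 0 <= x <= 1 -> height X (sigma x) = 2^-1 ->
  (forall d, 0 < d -> exists y, [/\ 0 <= y <= 1, x - d < y < x + d &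
     (y < x /\ height X (sigma y) < 2^-1) \/ (x < y /\ 2^-1 < height X (sigma y))]) ->
  exists e z, [/\ sigma x = Inner e z, X (tail e) & ~ X (head e)].
Proof.
move=> x01 hx near; case: wit => sc WE _ ord.
case E: (sigma x) hx => [v|e z|w] /=.
- by case: (levelP X (inl v)) => -[_ ->]; lra.
- have zP := valP z; move: (levelP X (inl (tail e))) (levelP X (inl (head e))).
  case=> [[/= Xt lt0]|[/= Xt lt0]]; case=> [[/= Xh lh]|[/= Xh lh]]; rewrite lt0 lh => hz.
  + by lra.
  + by exists e, z.
  (* On an edge into [X] the height falls from tail to head. Near time [x] the walk stays on this
     edge, so the times given by [near] contradict its direction. *)
  + exfalso; have : nbhs (sigma x) (@inner_edge R G e) by rewrite E; exact: inner_edge_nbhs.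
    move=> /(within_itv sc x01)[d d0 H].
    have [y [y01 yd yP]] := near d d0; have [z' _ zy] := H y y01 yd.
    move: yP; rewrite -zy /= lt0 lh => yP.
    have mem a : 0 <= a <= 1 -> inner_edge e (sigma a) -> (inner_edge e `&` W) (sigma a).
      by move=> a01 ea; split=> //; rewrite WE; exists a.
    have ex : (inner_edge e `&` W) (sigma x) by apply: mem => //; rewrite E; exists z.
    have ey : (inner_edge e `&` W) (sigma y) by apply: mem => //; rewrite -zy; exists z'.
    have ix : inner_points (sigma x) by exists e => //; case: ex.
    have iy : inner_points (sigma y) by exists e => //; case: ey.
    have eW : inner_edge e `&` W !=set0 by exists (sigma x).
    case: yP => -[xy hy].
      have /(dir eW ey ex) : lt (sigma y) (sigma x) by apply/ord.
      by rewrite E -zy => /edge_ltP /=; lra.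
    have /(dir eW ex ey) : lt (sigma x) (sigma y) by apply/ord.
    by rewrite E -zy => /edge_ltP /=; lra.
  + by lra.
- by case: (levelP X (inr w)) => -[_ ->]; lra.
Qed.

Lemma first_crossing (x1 : R) : 0 <= x1 <= 1 -> height X (sigma 0) = 0 ->
  height X (sigma x1) = 1 -> exists x e z,
  [/\ 0 <= x <= 1, sigma x = Inner e z, X (tail e) /\ ~ X (head e),
      height X (sigma x) = 2^-1 &
      forall y, 0 <= y -> y < x -> height X (sigma y) < 2^-1].
Proof.
move=> x11 h0 h1; case: (wit) => sc _ _ _.
have [x [x01 hx H]] := first_hit (height_itv_continuous sc) x11 h0 h1.
have x01' : 0 <= x <= 1 by lra.
have [|e [z [E Xt Xh]]] := crossing_edge x01' hx; last by exists x, e, z.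
move=> d d0; have [xd|xd] := leP x (d / 2).
  by exists 0; split; [lra|lra|left; split; [lra|apply: H; lra]].
by exists (x - d / 2); split; [lra|lra|left; split; [lra|apply: H; lra]].
Qed.

Lemma last_crossing (x0 : R) : 0 <= x0 <= 1 -> height X (sigma 1) = 1 ->
  height X (sigma x0) = 0 -> exists x e z,
  [/\ 0 <= x <= 1, sigma x = Inner e z, X (tail e) /\ ~ X (head e),
      height X (sigma x) = 2^-1 &
      forall y, y <= 1 -> x < y -> 2^-1 < height X (sigma y)].
Proof.
move=> x01 h1 h0; case: (wit) => sc _ _ _.
have [x [x01' hx H]] := last_hit (height_itv_continuous sc) x01 h1 h0.
have x01'' : 0 <= x <= 1 by lra.
have [|e [z [E Xt Xh]]] := crossing_edge x01'' hx; last by exists x, e, z.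
move=> d d0; have [xd|xd] := leP (1 - x) (d / 2).
  by exists 1; split; [lra|lra|right; split; [lra|apply: H; lra]].
by exists (x + d / 2); split; [lra|lra|right; split; [lra|apply: H; lra]].
Qed.

End Height.

Lemma side_closure X p : side X p -> vertex_set_closure X (pt p).
Proof.
case: p => [v Xv|w [r wr rX]]; first by left; exists v.
right; exists w, r; split=> //.
move=> [S fS sep]; have [k rk] := ray_avoid r fS.
apply: (sep (ray_vertex r k) (ray_vertex r k)); [by exists k|by apply: rX; exists k|].
by apply: conn_refl; exact: rk.
Qed.

(** A tail of the ray avoids the ball and is joined to [X] outside it; no edge of the cut is
    contracted, so this tail lies in [X]. *)
Lemma closure_side v0 n X p : locally_finite G -> saturated v0 n X ->
  vertex_set_closure X (pt p) -> side X p.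
Proof.
move=> lf sX; case: p => [v|w] /= [].
- by move=> [u Xu [<-]].
- by move=> [w [r []]].
- by move=> [].
move=> [_ [r [[<-] wr nsep]]].
have [N rN] := ray_avoid r (ball_finite v0 lf n).
have [k [b [Nk Xb kb]]] : exists k b,
    [/\ (N <= k)%N, X b & connected_avoiding (gball v0 n) (ray_vertex r k) b].
  (* Adding the first [N] vertices of the ray to the separator forces the connection to start in the
     tail. *)
  apply: contrapT => H; apply: nsep; exists (gball v0 n `|` ray_vertex r @` `I_N).
    by rewrite finite_setU; split; [exact: ball_finite|exact: finite_image].
  move=> _ b [k _ <-] Xb c; apply: H; exists k, b; split=> //.
    by rewrite leqNgt; apply/negP => kN; apply: (conn_avoidl c); right; exists k.
  by apply: conn_sub c => ?; left.
have cX u v : cpt v0 n u v -> X u -> X v.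
  move=> uv; apply: sX; rewrite (cls_inl uv) (cpt_eq uv).
  by rewrite (cls_inl (conn_sym uv)).
exists (ray_drop r k); first exact: end_closed wr (@ray_drop_equiv _ r k).
move=> _ [j _ <-] /=; apply: cX Xb; apply: conn_trans (conn_sym kb) _.
by apply: ray_conn (leq_addr _ _) => i ki; apply: rN; exact: leq_trans ki.
Qed.

(** The open edge is a neighbourhood of its inner point, so it has to meet an edge of [F]. *)
Lemma closure_inner F e z : edge_set_closure F (@Inner R G e z) -> F e.
Proof.
move=> /(_ _ (inner_edge_nbhs e z))[_ [[f [x [Ff _ <-]]] [y _ /esym]]].
by move=> /edge_point_inner[<-].
Qed.

Lemma ecard_gt0 (A : set (edge G)) : finite_set A -> A !=set0 -> (1 <= ecard A)%N.
Proof.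
by move=> fA [e Ae]; rewrite /ecard cardfs_gt0; apply/fset0Pn; exists e; rewrite in_fset_set// inE.
Qed.

Section SaturatedClasses.
Context {v0 : vertex G} (lf : locally_finite G).

(** Two nodes with different classes are therefore separated by a finite cut that has one of the
    classes as a side. *)
Lemma cls_saturated n p : saturated v0 n (cls v0 n p).
Proof.
move=> u v uv /(cls_eq lf) pu; rewrite pu uv; exact: cls_refl.
Qed.

Lemma side_cls_self n p : side (cls v0 n p) p.
Proof.
by have [v pv] := cls_ex v0 lf n p; apply/(side_cls lf (@cls_saturated n p) pv).
Qed.

Lemma side_cls_other n p q : cls v0 n p <> cls v0 n q -> side (~` cls v0 n p) q.
Proof.
have [v qv] := cls_ex v0 lf n q.
move=> pq; apply/(sideC lf _ (@cls_saturated n p)).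
move=> /(side_cls lf (@cls_saturated n p) qv) pv; apply: pq.
exact: cls_common pv qv.
Qed.

Lemma heightC n X (x : fpoint R G) : saturated v0 n X -> height (~` X) x = 1 - height X x.
Proof.
move=> sX; have lC p : level (~` X) p = 1 - level X p.
  case: (levelP X p) => -[Xp ->]; case: (levelP (~` X) p) => -[Yp ->]; rewrite ?subrr ?subr0//.
    by case/(sideC lf p sX): Yp.
  by exfalso; apply: Yp; apply/(sideC lf p sX).
by case: x => [v|e z|w] /=; rewrite ?lC//; lra.
Qed.

Lemma height_side X p : side X p -> height X (pt p) = 0.
Proof. by rewrite height_pt; case: (levelP X p) => -[]. Qed.

Lemma height_sideC n X p : saturated v0 n X -> side (~` X) p -> height X (pt p) = 1.
Proof.
by move=> sX /height_side; rewrite (heightC _ sX); lra.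
Qed.

End SaturatedClasses.

Lemma witness_image (W : set (fpoint R G)) lt sigma rho (x : R) :
  is_witness W lt sigma -> is_witness W lt rho -> 0 <= x <= 1 ->
  exists2 y, 0 <= y <= 1 & rho y = sigma x.
Proof.
move=> [_ WE _ _] [_ WE' _ _] x01.
have : W (sigma x) by rewrite WE; exists x.
by rewrite WE' => -[y]; rewrite /= in_itv /=; exists y.
Qed.

(** Two witnesses of one walk visit the same inner points in the same order, so a relation between a
    point of each can be read off on either. *)
Lemma witness_lt (W : set (fpoint R G)) lt sigma rho (x y : R) :
  is_witness W lt sigma -> is_witness W lt rho ->
  0 <= x <= 1 -> 0 <= y <= 1 ->
  inner_points (sigma x) -> inner_points (rho y) -> lt (sigma x) (rho y) ->
  (exists2 x', 0 <= x' < y & rho x' = sigma x) /\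
  (exists2 y', x < y' <= 1 & sigma y' = rho y).
Proof.
move=> ws wr x01 y01 ix iy xy; split.
  have [x' x'01 E] := witness_image ws wr x01; exists x' => //.
  have x'y : x' < y.
    by case: wr => _ _ _ ord; apply/ord => //; rewrite E.
  by rewrite x'y; case/andP: x'01 => ->.
have [y' y'01 E] := witness_image wr ws y01; exists y' => //.
have xy' : x < y'.
  by case: ws => _ _ _ ord; apply/ord => //; rewrite E.
by rewrite xy'; case/andP: y'01 => _ ->.
Qed.

(** * Endpoints of the witnesses of a directed walk *)

Section Endpoints.
Context (lf : locally_finite G) (wc : weakly_connected G).
Context {W : set (fpoint R G)} {lt : fpoint R G -> fpoint R G -> Prop}.
Hypothesis (lin : strict_linear_order_on (inner_points `&` W) lt).
Hypothesis (dir : directed W lt).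
Context {sigma rho : R -> fpoint R G}.
Hypothesis (ws : is_witness W lt sigma) (wr : is_witness W lt rho).

Lemma inner_order (x y : R) e z f z' : 0 <= x <= 1 -> 0 <= y <= 1 ->
  sigma x = Inner e z -> rho y = Inner f z' -> e <> f ->
  [/\ inner_points (sigma x), inner_points (rho y) &
    lt (sigma x) (rho y) \/ lt (rho y) (sigma x)].
Proof.
move=> x01 y01 xe yf ef.
have ix : inner_points (sigma x) by rewrite xe; exists e => //; exists z.
have iy : inner_points (rho y) by rewrite yf; exists f => //; exists z'.
split=> //; case: lin => _ _; apply; last by rewrite xe yf => -[].
- by split=> //; case: ws => _ -> _ _; exists x.
- by split=> //; case: wr => _ -> _ _; exists y.
Qed.

Let zero01 : 0 <= (0 : R) <= 1. Proof. by rewrite lexx ler01. Qed.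
Let one01 : 0 <= (1 : R) <= 1. Proof. by rewrite lexx ler01. Qed.

(* Otherwise each walk has a first exit from the side of a cut on which it
   starts, and each of the two exits would precede the other. *)
Lemma witness_start s p : sigma 0 = pt s -> rho 0 = pt p -> p = s.
Proof.
move=> s0 r0; apply: contrapT => ps.
have [v0] := node_vertex s.
have [n sep] := cls_sep v0 lf wc ps.
have sX := @cls_saturated v0 lf n p; have sY := saturatedC sX.
have Xp := side_cls_self (v0 := v0) lf n p; have Ys := side_cls_other lf sep.
move: sX sY Xp Ys; set X := cls v0 n p => sX sY Xp Ys.
have [y1 y101 y1E] := witness_image ws wr zero01.
have [x1 x101 x1E] := witness_image wr ws zero01.
have [||y [f [z' [y01 yf [Xt Xh] hy Hy]]]] := first_crossing lf sX wr dir y101.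
- by rewrite r0 (height_side Xp).
- by rewrite y1E s0 (height_sideC lf sX Ys).
have [||x [e [z [x01 xe [Yt Yh] hx Hx]]]] := first_crossing lf sY ws dir x101.
- by rewrite s0 (height_side Ys).
- by rewrite x1E r0 (heightC lf _ sX) (height_side Xp) subr0.
have ef : e <> f by move=> E; apply: Yt; rewrite E.
rewrite (heightC lf _ sX) in hx.
have [ix iy [xy|yx]] := inner_order x01 y01 xe yf ef.
- have [[x' /andP[x'0 x'y] E] _] := witness_lt ws wr x01 y01 ix iy xy.
  by have := Hy _ x'0 x'y; rewrite E; lra.
- have [[y' /andP[y'0 y'x] E] _] := witness_lt wr ws y01 x01 iy ix yx.
  by have := Hx _ y'0 y'x; rewrite E (heightC lf _ sX); lra.
Qed.

(** The mirror image of [witness_start], with the last entry into the side of a cut on which each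
    walk ends. *)
Lemma witness_end t q : sigma 1 = pt t -> rho 1 = pt q -> q = t.
Proof.
move=> s1 r1; apply: contrapT => qt.
have [v0] := node_vertex t.
have [n sep] := cls_sep v0 lf wc qt.
have sX := @cls_saturated v0 lf n q; have sY := saturatedC sX.
have Xq := side_cls_self (v0 := v0) lf n q; have Yt := side_cls_other lf sep.
move: sX sY Xq Yt; set X := cls v0 n q => sX sY Xq Yt.
have [y1 y101 y1E] := witness_image ws wr one01.
have [x1 x101 x1E] := witness_image wr ws one01.
have [||y [f [z' [y01 yf [Xt Xh] hy Hy]]]] := last_crossing lf sY wr dir y101.
- by rewrite r1 (heightC lf _ sX) (height_side Xq) subr0.
- by rewrite y1E s1 (height_side Yt).
have [||x [e [z [x01 xe [Yt' Yh] hx Hx]]]] := last_crossing lf sX ws dir x101.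
- by rewrite s1 (height_sideC lf sX Yt).
- by rewrite x1E r1 (height_side Xq).
have ef : e <> f by move=> E; apply: Xt; rewrite -E.
rewrite (heightC lf _ sX) in hy.
have [ix iy [xy|yx]] := inner_order x01 y01 xe yf ef.
- have [_ [y' /andP[xy' y'1] E]] := witness_lt ws wr x01 y01 ix iy xy.
  by have := Hx _ y'1 xy'; rewrite E; lra.
- have [_ [x' /andP[yx' x'1] E]] := witness_lt wr ws y01 x01 iy ix yx.
  by have := Hy _ x'1 yx'; rewrite E (heightC lf _ sX); lra.
Qed.

End Endpoints.

(** A directed topological walk from [s] to [t] constrains all its witnesses, so the one that is
    constructed has to determine the endpoints of every other. *)
Lemma witness_endpoints (lf : locally_finite G) (wc : weakly_connected G)
    (W : set (fpoint R G)) lt sigma rho s t :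
  strict_linear_order_on (inner_points `&` W) lt -> directed W lt ->
  is_witness W lt sigma -> is_witness W lt rho ->
  sigma 0 = pt s -> sigma 1 = pt t -> rho 0 = pt s /\ rho 1 = pt t.
Proof.
move=> lin dir ws wr s0 s1.
(* An inner point is neither first nor last on [sigma], whose neighbouring
   inner points of the same edge also lie on [rho]. *)
have near (x : R) e z : 0 <= x <= 1 -> sigma x = Inner e z -> exists y y',
    [/\ 0 <= y, y < x, x < y', y' <= 1 & inner_edge e (sigma y) /\ inner_edge e (sigma y')].
  move=> x01 xe; have x0 : x <> 0.
    by move=> E; apply: (@pt_inner s e z); rewrite -s0 -E.
  have x1 : x <> 1 by move=> E; apply: (@pt_inner t e z); rewrite -s1 -E.
  have {}x0 : 0 < x by rewrite lt_neqAle eq_sym; move/eqP: x0 => ->; case/andP: x01.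
  have {}x1 : x < 1 by rewrite lt_neqAle; move/eqP: x1 => ->; case/andP: x01.
  have [d d0 H] : exists2 d, 0 < d & forall y, 0 <= y <= 1 -> x - d < y < x + d ->
      inner_edge e (sigma y).
    by case: ws => sc _ _ _; apply: within_itv => //; rewrite xe; exact: inner_edge_nbhs.
  pose k := Num.min (d / 2) (Num.min x (1 - x)).
  have kd : k <= d / 2 by rewrite ge_min lexx.
  have kx : k <= x by rewrite !ge_min lexx orbT.
  have kx1 : k <= 1 - x by rewrite !ge_min lexx !orbT.
  have k0 : 0 < k by rewrite !lt_min; lra.
  by exists (x - k), (x + k); split; [lra|lra|lra|lra|split; apply: H; lra].
have sord : forall x y : R, 0 <= x <= 1 -> 0 <= y <= 1 ->
  inner_points (sigma x) -> inner_points (sigma y) ->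
  (lt (sigma x) (sigma y) <-> x < y) by case: ws.
have inn e (x : fpoint R G) : inner_edge e x -> inner_points x by exists e.
split.
- case r0 : (rho 0) => [v|e z|w].
  + by rewrite -(witness_start (p := inl v) lf wc lin dir ws wr s0 r0).
  (* If [rho 0] were an inner point, the order would make [rho] visit a smaller inner point of the
     same edge before time 0. *)
  + have [|x x01 xE] := witness_image wr ws (x := 0); first by rewrite lexx ler01.
    have [y [_ [y0 yx _ _ [ye _]]]] := near x e z x01 (etrans xE r0).
    have ix : inner_edge e (sigma x) by rewrite xE r0; exists z.
    have y01 : 0 <= y <= 1 by lra.
    have /(sord _ _ y01 x01 (inn _ _ ye) (inn _ _ ix)) := yx; rewrite xE => yl.
    have i0 : inner_points (rho 0) by rewrite -xE; exact: inn ix.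
    have h0 : 0 <= (0 : R) <= 1 by rewrite lexx ler01.
    have [[x' /andP[a /(le_lt_trans a)]]] := witness_lt ws wr y01 h0 (inn _ _ ye) i0 yl.
    by rewrite ltxx.
  + by rewrite -(witness_start (p := inr w) lf wc lin dir ws wr s0 r0).
- case r1 : (rho 1) => [v|e z|w].
  + by rewrite -(witness_end (q := inl v) lf wc lin dir ws wr s1 r1).
  + have [|x x01 xE] := witness_image wr ws (x := 1); first by rewrite lexx ler01.
    have [_ [y [_ _ xy y1 [_ ye]]]] := near x e z x01 (etrans xE r1).
    have ix : inner_edge e (sigma x) by rewrite xE r1; exists z.
    have y01 : 0 <= y <= 1 by lra.
    have /(sord _ _ x01 y01 (inn _ _ ix) (inn _ _ ye)) := xy; rewrite xE => yl.
    have i1 : inner_points (rho 1) by rewrite -xE; exact: inn ix.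
    have h1 : 0 <= (1 : R) <= 1 by rewrite lexx ler01.
    have [_ [x' /andP[a /(lt_le_trans a)]]] := witness_lt wr ws h1 y01 i1 (inn _ _ ye) yl.
    by rewrite ltxx.
  + by rewrite -(witness_end (q := inr w) lf wc lin dir ws wr s1 r1).
Qed.

Lemma cut_edge_of_walk (lf : locally_finite G) (wc : weakly_connected G) s t F X Y :
  contains_directed_topological_walk (edge_set_closure F) (pt s) (pt t) ->
  finite_cut X Y -> vertex_set_closure X (pt s) -> vertex_set_closure Y (pt t) ->
  F `&` edges_from X Y !=set0.
Proof.
move=> [W [lt [WF [[lin [sigma wit]] dir ends]]]] [/cutC -> fX] Xs Yt.
have [v0] := node_vertex s.
have [n sX] := finite_saturated v0 lf wc fX.
have {}Xs := closure_side lf sX Xs.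
have {}Yt := closure_side lf (saturatedC sX) Yt.
have [s0 s1] := ends _ wit.
have [|||x [e [z [x01 xE [Xt Xh] _ _]]]] := first_crossing lf sX wit dir (x1 := 1).
- by rewrite ler01 lexx.
- by rewrite s0 (height_side Xs).
- by rewrite s1 (height_sideC lf sX Yt).
exists e; split=> //; apply: (@closure_inner F e z); apply: WF.
by case: wit => _ -> _ _; exists x.
Qed.

End Space.

(** * The topological walk of compatible trails *)

Section WalkConstruction.
Local Open Scope ring_scope.
Context {R : realType} {G : digraph} {v0 : vertex G}.
Hypothesis (lf : locally_finite G) (wc : weakly_connected G).
Context {F : set (edge G)} {s t : @node G} {P : nat -> seq (edge G)}.
Hypothesis (cP : coherent v0 F s t P) (st : s <> t).
Context {a b : edge G -> R}.
Hypothesis abP : forall e, limit_edge P e -> [/\ 0 <= a e, a e < b e & b e <= 1].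
Hypothesis ab_prec : forall e f, limit_edge P e -> limit_edge P f ->
  prec P e f -> b e <= a f.
Implicit Types (e f : edge G) (n m : nat) (x y : R) (u w : seq (edge G)).

(** The class in which this part of the trail ends is the position at time [x] in the contracted
    digraph. *)
Definition prefix n x := [seq e <- P n | b e <= x].

Lemma limit_edgeP n e : e \in P n -> limit_edge P e.
Proof. by exists n. Qed.

Lemma ab_cat n u w e f : P n = u ++ w -> e \in u -> f \in w -> b e <= a f.
Proof.
move=> E eu fw.
have em : e \in P n by rewrite E mem_cat eu.
have fm : f \in P n by rewrite E mem_cat fw orbT.
apply: (ab_prec (limit_edgeP em) (limit_edgeP fm)); exists n; rewrite E -cat1s.
by apply: cat_subseq; rewrite sub1seq.
Qed.

Lemma b_cat n u w e f : P n = u ++ w -> e \in u -> f \in w -> b e < b f.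
Proof.
move=> E eu fw; apply: le_lt_trans (ab_cat E eu fw) _.
by have [] := abP (limit_edgeP (n := n) (e := f) _); rewrite // E mem_cat fw orbT.
Qed.

Lemma prefix_cat n u w x : P n = u ++ w -> (forall e, e \in u -> b e <= x) ->
  (forall e, e \in w -> x < b e) -> prefix n x = u.
Proof.
move=> E ux wx; rewrite /prefix E filter_cat.
rewrite (all_filterP _); last by apply/allP.
rewrite (eq_in_filter (a2 := pred0)) ?filter_pred0 ?cats0// => e /wx.
by rewrite ltNge => /negbTE.
Qed.

(** The ends of the intervals increase along the trail, so the edges completed by time [x] form an
    initial segment. *)
Lemma prefix_split n x : exists2 w, P n = prefix n x ++ w & forall e, e \in w -> x < b e.
Proof.
have gen u w : P n = u ++ w -> exists2 w', w = [seq e <- w | b e <= x] ++ w' &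
    forall e, e \in w' -> x < b e.
  elim: w u => [|e w IH] u E /=; first by exists [::].
  have [ex|xe] := leP (b e) x.
    have [|w' wE w'x] := IH (rcons u e); first by rewrite cat_rcons.
    by exists w' => //; rewrite /= -wE.
  exists (e :: w) => [|f].
    rewrite (eq_in_filter (a2 := pred0)) ?filter_pred0// => f fw; apply/negbTE.
    rewrite -ltNge; apply: lt_trans xe _.
    apply: (b_cat (u := rcons u e) (w := w) (n := n)) => //; first by rewrite cat_rcons.
    by rewrite mem_rcons mem_head.
  rewrite inE => /orP[/eqP->//|fw]; apply: lt_trans xe _.
  apply: (b_cat (u := rcons u e) (w := w) (n := n)) => //; first by rewrite cat_rcons.
  by rewrite mem_rcons mem_head.
by have [w' ? ?] := gen [::] (P n) erefl; exists w'.
Qed.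

Lemma tail_position n u w e x : P n = u ++ e :: w -> a e <= x -> x < b e ->
  walk v0 n s (prefix n x) (inl (tail e)).
Proof.
move=> E ax xb; rewrite (prefix_cat E).
- have := coh_walk cP n; rewrite E => /walk_cat[z sz /= [ze _]].
  exact: walk_end sz.
- by move=> f fu; apply: le_trans ax; apply: (ab_cat E) => //; rewrite mem_head.
- move=> f; rewrite inE => /orP[/eqP->//|fw]; apply: lt_trans xb _.
  apply: (b_cat (u := rcons u e) (w := w) (n := n)) => //; first by rewrite cat_rcons.
  by rewrite mem_rcons mem_head.
Qed.

Lemma head_position n u w e : P n = u ++ e :: w ->
  walk v0 n s (prefix n (b e)) (inl (head e)).
Proof.
rewrite -cat_rcons => E; rewrite (prefix_cat E).
- have := coh_walk cP n; rewrite E => /walk_cat[z sz _].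
  by have [se zE] := walk_rcons sz; exact: walk_end sz.
- move=> f; rewrite mem_rcons inE => /orP[/eqP->//|fu]; rewrite ltW//.
  rewrite cat_rcons in E; apply: (b_cat E) => //; exact: mem_head.
- by move=> f fw; apply: (b_cat E) => //; rewrite mem_rcons mem_head.
Qed.

Lemma prefix_le n m x : (n <= m)%N -> [seq e <- prefix m x | nonloop v0 n e] = prefix n x.
Proof.
move=> nm; rewrite /prefix -(coh_filter cP nm) -!filter_predI.
by apply: eq_filter => e /=; rewrite andbC.
Qed.

Lemma walk_prefix_le n m x q : (n <= m)%N ->
  walk v0 m s (prefix m x) q -> walk v0 n s (prefix n x) q.
Proof. by move=> nm /(walk_filter lf nm); rewrite prefix_le. Qed.

(** The classes reached at the various levels are compatible, because restricting a prefix gives the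
    prefix of the restricted trail; [limit_node] supplies their limit. *)
Lemma position_ex x : exists p, forall n, walk v0 n s (prefix n x) p.
Proof.
have wex n : exists p, walk v0 n s (prefix n x) p.
  have [w E _] := prefix_split n x; have := coh_walk cP n.
  by rewrite {1}E => /walk_cat[z ? _]; exists z.
have [q qP] := choice wex.
have [|p pE] := @limit_node _ v0 lf wc q.
  by move=> n m nm; exact: walk_end_eq (walk_prefix_le nm (qP m)) (qP n).
by exists p => n; apply: walk_end (qP n).
Qed.

Lemma position_eq x p q : (forall n, walk v0 n s (prefix n x) p) ->
  (forall n, walk v0 n s (prefix n x) q) -> p = q.
Proof.
move=> hp hq; apply: contrapT => /(cls_sep v0 lf wc)[n]; apply.
exact: walk_end_eq (hp n) (hq n).
Qed.

(** The bounds are strict: at the ends of the interval, [sigma] takes its value from [pos]. *)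
Definition in_edge x e := limit_edge P e /\ a e < x < b e.

Definition param e x := (x - a e) / (b e - a e).

Lemma in_edge_uniq x e f : in_edge x e -> in_edge x f -> e = f.
Proof.
move=> [le xe] [lf' xf]; apply: contrapT => /(prec_total cP le lf').
by case=> [/(ab_prec le lf')|/(ab_prec lf' le)]; lra.
Qed.

Lemma param01 x e : in_edge x e -> 0 < param e x < 1.
Proof.
move=> [_ /andP[ax xb]]; rewrite /param divr_gt0 ?subr_gt0//=; last exact: lt_trans xb.
by rewrite ltr_pdivrMr ?mul1r ?ltrD2r// subr_gt0; exact: lt_trans xb.
Qed.

Lemma param_lt x y e : limit_edge P e -> (param e x < param e y) = (x < y).
Proof.
by move=> /abP[_ ab _]; rewrite ltr_pM2r ?ltrD2r// invr_gt0 subr_gt0.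
Qed.

Context {pos : R -> @node G} {sigma : R -> fpoint R G}.
Hypothesis posP : forall x n, walk v0 n s (prefix n x) (pos x).
Hypothesis sigma_in : forall x e, in_edge x e -> sigma x = edge_point e (param e x).
Hypothesis sigma_out : forall x, (forall e, ~ in_edge x e) -> sigma x = pt (pos x).

Lemma sigma_inner x e : in_edge x e ->
  exists2 z : {x : R | 0 < x < 1}, sigma x = Inner e z & val z = param e x.
Proof.
move=> xe; rewrite (sigma_in xe) /edge_point; have := param01 xe.
by case: insubP => [z _ zE _|/negP//]; exists z.
Qed.

Lemma inner_sigma x e z : sigma x = Inner e z -> in_edge x e /\ val z = param e x.
Proof.
have [[f xf]|out] := pselect (exists f, in_edge x f).
  by have [z' -> zE] := sigma_inner xf; case=> <- <-.
rewrite sigma_out; first by move/pt_inner.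
by move=> f xf; apply: out; exists f.
Qed.

Lemma cls_position n x q : walk v0 n s (prefix n x) q -> cls v0 n q = cls v0 n (pos x).
Proof. by move=> h; exact: walk_end_eq h (posP x n). Qed.

Lemma common_radius (l : seq (edge G)) x (Q : edge G -> R -> Prop) :
  (forall e, e \in l -> exists2 d, 0 < d & forall y, x - d < y < x + d -> Q e y) ->
  exists2 d, 0 < d & forall y, x - d < y < x + d -> forall e, e \in l -> Q e y.
Proof.
elim: l => [|e l IH] H; first by exists 1.
have [d d0 dl] := IH (fun f fl => H f (mem_behead (s := e :: l) fl)).
have [c c0 ce] := H e (mem_head _ _).
exists (Num.min c d); first by rewrite lt_min c0.
have h1 : Num.min c d <= c by rewrite ge_min lexx.
have h2 : Num.min c d <= d by rewrite ge_min lexx orbT.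
move=> y xy f; rewrite inE => /orP[/eqP->|fl]; [apply: ce|apply: dl] => //; lra.
Qed.

(** [P n] is finite, so near [x] only those of its intervals matter that begin or end at [x].
    Outside them, the set of completed edges does not change. *)
Lemma near_prefix n x eps : 0 < eps -> (forall e, e \in P n -> ~ in_edge x e) ->
  exists2 d, 0 < d & forall y, x - d < y < x + d ->
    (exists2 e, e \in P n & in_edge y e /\
       ((x = a e /\ param e y < eps) \/ (x = b e /\ 1 - param e y < eps))) \/
    ((forall e, e \in P n -> ~ in_edge y e) /\ prefix n y = prefix n x).
Proof.
move=> eps0 out.
pose Q e y := (in_edge y e /\
       ((x = a e /\ param e y < eps) \/ (x = b e /\ 1 - param e y < eps))) \/
    (~ in_edge y e /\ (b e <= y) = (b e <= x)).
have [|d d0 H] := @common_radius (P n) x Q.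
  move=> e en; have le := limit_edgeP en; have [a0 ab b1] := abP le.
  have nx : ~ (a e < x < b e) by move=> h; apply: (out e en).
  have ba0 : 0 < b e - a e by lra.
  have k0 : 0 < eps * (b e - a e) by rewrite mulr_gt0.
  (* The first bound turns a time difference into a parameter difference below [eps], the second
     keeps [y] within the interval. *)
  pose k := Num.min (eps * (b e - a e)) (b e - a e).
  have k0' : 0 < k by rewrite lt_min k0.
  have k1 : k <= eps * (b e - a e) by rewrite ge_min lexx.
  have k2 : k <= b e - a e by rewrite ge_min lexx orbT.
  have [xa|ax|xa] := ltgtP x (a e).
  - exists (a e - x); first lra.
    move=> y xy; right; split; first by move=> [_]; lra.
    by apply/idP/idP; lra.
  - have bx : b e <= x by rewrite leNgt; apply/negP => xb; apply: nx; lra.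
    move: bx; rewrite le_eqVlt => /orP[/eqP bx|bx].
      exists k => // y xy; have [yx|xy'] := ltP y x.
        left; split; first by split=> //; lra.
        right; split=> //; rewrite /param.
        rewrite (_ : 1 - _ = (b e - y) / (b e - a e)); last by field; rewrite gt_eqF.
        by rewrite ltr_pdivrMr//; lra.
      right; split; first by move=> [_]; lra.
      by apply/idP/idP; lra.
    exists (x - b e); first lra.
    move=> y xy; right; split; first by move=> [_]; lra.
    by apply/idP/idP; lra.
  - exists k => // y xy; have [yx|xy'] := leP y x.
      right; split; first by move=> [_]; lra.
      by apply/idP/idP; lra.
    left; split; first by split=> //; lra.
    by left; split=> //; rewrite /param ltr_pdivrMr//; lra.
exists d => // y /H {}H.
have [[e en ye]|no] := pselect (exists2 e, e \in P n & in_edge y e).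
  by left; exists e => //; case: (H e en) => // -[].
right; split; first by move=> e en ye; apply: no; exists e.
apply: eq_in_filter => e en; case: (H e en) => -[ye //].
by exfalso; apply: no; exists e.
Qed.

(* The points of [|G|] that [sigma] takes near [x] when seen in the digraph in
   which the components of [G - gball v0 n] are contracted. *)
Definition approx n x eps (p : fpoint R G) : Prop :=
  [\/ exists2 q, p = pt q & cls v0 n q = cls v0 n (pos x),
      exists e z, [/\ p = Inner e z, cls v0 n (inl (tail e)) = cls v0 n (pos x) &
        cls v0 n (inl (head e)) = cls v0 n (pos x)] |
      exists e z v, [/\ p = Inner e z, nonloop v0 n e,
        cls v0 n (inl v) = cls v0 n (pos x) & close_to e v (val z) eps]].

(** By [near_prefix], either [sigma y] is on a partial edge at the class of [pos x], or the position
    at level [n] is unchanged. In the second case, an edge that is being traversed is contracted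
    into that class. *)
Lemma sigma_near n x eps : 0 < eps -> (forall e, ~ in_edge x e) ->
  exists2 d, 0 < d & forall y, x - d < y < x + d -> approx n x eps (sigma y).
Proof.
move=> eps0 out; have [|d d0 H] := @near_prefix n x eps eps0; first by move=> e _; exact: out.
exists d => // y /H[[e en [ye ee]]|[nout E]].
  have [z zE zv] := sigma_inner ye; apply: Or33.
  have te := coh_nonloop cP en.
  have [u [w E]] : exists u w, P n = u ++ e :: w by case/splitPr: en => u w; exists u, w.
  have [_ ab _] := abP (limit_edgeP en).
  case: ee => -[xE pe].
    exists e, z, (tail e); split=> //; last by left; rewrite zv.
    by apply: cls_position; apply: (tail_position E); rewrite xE.
  exists e, z, (head e); split=> //; last by right; rewrite zv.
  by apply: cls_position; rewrite xE; exact: head_position E.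
have [[e ye]|yout] := pselect (exists e, in_edge y e); last first.
  apply: Or31; exists (pos y); first by rewrite sigma_out// => e ye; apply: yout; exists e.
  by apply: cls_position; rewrite -E; exact: posP.
have [z zE zv] := sigma_inner ye; apply: Or32; exists e, z.
have nte : ~~ nonloop v0 n e.
  by apply/negP => /(coh_mem cP (proj1 ye)) en; exact: nout ye.
suff h : cls v0 n (inl (tail e)) = cls v0 n (pos x) by rewrite -(loop_cls nte).
(* The edge does not occur at level [n]; a finer level at which it does locates its tail. *)
have [m nm em] := limit_edge_mem cP n (proj1 ye).
have [u [w Em]] : exists u w, P m = u ++ e :: w by case/splitPr: em => u w; exists u, w.
apply: cls_position; rewrite -E; apply: (walk_prefix_le nm).
by case: ye => _ /andP[/ltW ay yb]; exact: tail_position Em ay yb.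
Qed.

Lemma sigma_continuous : continuous sigma.
Proof.
move=> x A /= nA; apply/nbhs_itv.
have [[e xe]|out] := pselect (exists e, in_edge x e).
  have [le /andP[ax xb]] := xe; have ba : 0 < b e - a e by lra.
  have := @edge_point_continuous R G e (param e x) A.
  rewrite -(sigma_in xe) => /(_ nA); rewrite /= => /nbhs_itv[d d0 H].
  pose k := Num.min (d * (b e - a e)) (Num.min (x - a e) (b e - x)).
  have k0 : 0 < k by rewrite !lt_min mulr_gt0//= !subr_gt0 ax.
  have k1 : k <= d * (b e - a e) by rewrite ge_min lexx.
  have k2 : k <= x - a e by rewrite !ge_min lexx orbT.
  have k3 : k <= b e - x by rewrite !ge_min lexx !orbT.
  exists k => // y xy; have ye : in_edge y e by split=> //; lra.
  rewrite (sigma_in ye); apply: H.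
  have -> : param e y = param e x + (y - x) / (b e - a e).
    by rewrite /param; field; rewrite gt_eqF.
  by rewrite !ltrD2l ltr_pdivlMr// ltr_pdivrMr// mulNr; lra.
have {}out e : ~ in_edge x e by move=> xe; apply: out; exists e.
have [N xN NA] := basic_nbhs nA; rewrite sigma_out// in xN.
(* Take a ball that contains the vertex [pos x], or the set [S] that defines the neighbourhood of
   the end [pos x]. Then the class of [pos x] is this single vertex, or lies inside [C]. *)
suff [n [eps eps0 H]] : exists n, exists2 eps, 0 < eps & approx n x eps `<=` N.
  by have [d d0 dP] := sigma_near n eps0 out; exists d => // y /dP/H/NA.
case E : (pos x) xN => [v|w] /=.
  move=> [eps /andP[eps0 _] ->]; have [n bv] := ball_cover v0 wc v.
  have vE q : cls v0 n q = cls v0 n (pos x) -> q = inl v.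
    by rewrite E => qv; apply: (cls_ball lf bv); rewrite qv; exact: cls_refl.
  exists n, eps => // p [[q -> /vE->//]|[e [z [_ /vE tv /vE hv]]]|[e [z [u [-> _ /vE [<-]]]]] //].
  by case: (@no_loop G e); move: tv hv => [->] [->].
move=> [S [C [eps [fS cC wC /andP[eps0 _] ->]]]].
have [n Sn] := ball_cover_fin v0 wc fS; exists n, eps => //.
have [v wv] := cls_ex v0 lf n (inr w); have [nv wE] := cls_inr lf wv.
have CC : cpt v0 n v `<=` C.
  exact: end_component_sub (ball_finite v0 lf n) Sn cC (cpt_component nv) wC wv.
have qE q : cls v0 n q = cls v0 n (pos x) -> cls v0 n q = cpt v0 n v by rewrite E wE.
have uE (u : vertex G) : cls v0 n (inl u) = cls v0 n (pos x) -> cpt v0 n v u.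
  by move=> /qE <-; exact: cls_refl.
apply: subset_trans (end_nbhdS (d := eps) Sn CC cC (lexx _)).
move=> p [[[u|w'] ->]|[e [z [-> /uE tv /uE hv]]]|[e [z [u [-> te /uE uv cl]]]]] /=.
- exact: uE.
- move=> /qE wE'; suff : cls v0 n (inr w') v by [].
  by rewrite wE'; exact: cpt_refl.
- by left.
right; have nu := conn_avoidr uv.
case: cl => -[eu cl]; [exists u, (head e)|exists u, (tail e)]; split=> //.
- by case/(nonloopP v0 lf): te => //; rewrite eu.
- by left.
- by left.
- by case/(nonloopP v0 lf): te => //; rewrite eu.
- by right.
- by right.
Qed.

Lemma edge_point0 e : @edge_point R G e 0 = Vtx (tail e).
Proof. by rewrite /edge_point insubN ?ltxx// lexx. Qed.

Lemma edge_point1 e : @edge_point R G e 1 = Vtx (head e).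
Proof. by rewrite /edge_point insubN ?ltxx ?andbF// lt_geF ?ltr01. Qed.

(** If some edge of [P n] is not yet completed, the next one starts in the class of [pos x];
    otherwise the last one has ended there. *)
Lemma incident_limit_edge n x : P n != [::] -> exists e v, [/\ F e,
  edge_set_points F (@Vtx R G v) & cls v0 n (inl v) = cls v0 n (pos x)].
Proof.
move=> nP; have [w E _] := prefix_split n x.
case: w E => [|e w] E; last first.
  have Fe : F e by apply: (coh_sub cP (n := n)); rewrite E mem_cat mem_head orbT.
  exists e, (tail e); split=> //; first by exists e, 0; rewrite edge_point0 lexx ler01.
  have := coh_walk cP n; rewrite E => /walk_cat[z sz [ze _]].
  by rewrite -ze; exact: cls_position.
move: nP (posP x n); rewrite E cats0.
case/lastP: (prefix n x) E => [//|u e] E _ /walk_rcons[_ hE].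
have Fe : F e by apply: (coh_sub cP (n := n)); rewrite E cats0 mem_rcons mem_head.
by exists e, (head e); split=> //; exists e, 1; rewrite edge_point1 lexx ler01.
Qed.

(** Outside the intervals, each neighbourhood of [pos x] contains all vertices of its class at a
    fine level. One of them is an endvertex of an edge of [F], as [P n] is not empty once [s] and
    [t] have different classes. *)
Lemma sigma_closure x : edge_set_closure F (sigma x).
Proof.
have [[e xe]|out] := pselect (exists e, in_edge x e).
  apply: subset_closure; exists e, (param e x); rewrite (sigma_in xe); split=> //.
    exact: (limit_edgeF cP (proj1 xe)).
  by case/andP: (param01 xe) => /ltW-> /ltW->.
rewrite sigma_out; last by move=> e xe; apply: out; exists e.
move=> A /basic_nbhs[N xN NA].
have [N0 N0P] := coh_nonempty lf wc cP st.
suff [n [Nn H]] : exists n, (N0 <= n)%N /\ forall v,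
    cls v0 n (inl v) = cls v0 n (pos x) -> N (Vtx v).
  have [e [v [_ vF /H/NA Av]]] := incident_limit_edge x (N0P n Nn).
  by exists (Vtx v).
case E : (pos x) xN => [v|w] /=.
  move=> [eps /andP[eps0 _] ->]; have [n bv] := ball_cover v0 wc v.
  exists (maxn N0 n); split=> [|u]; first exact: leq_maxl.
  have {}bv := ball_le (leq_maxr N0 n) bv => uv.
  have uv' : cls v0 (maxn N0 n) (inl u) v by rewrite uv; exact: cls_refl.
  by have [] := cls_ball lf bv uv'.
move=> [S [C [eps [fS cC wC _ ->]]]].
have [n Sn] := ball_cover_fin v0 wc fS.
exists (maxn N0 n); split=> [|u uw]; first exact: leq_maxl.
have {}Sn : S `<=` gball v0 (maxn N0 n) by apply: subset_trans Sn _; apply: ball_le; exact: leq_maxr.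
have wu : cls v0 (maxn N0 n) (inr w) u by rewrite -uw; exact: cls_refl.
have [nu wE] := cls_inr lf wu.
apply: (end_component_sub (ball_finite v0 lf _) Sn cC (cpt_component nu) wC wu).
exact: cpt_refl.
Qed.

Lemma sigma_start : sigma 0 = pt s.
Proof.
rewrite sigma_out; last by move=> e [/abP[a0 _ _]]; lra.
congr pt; apply: (@position_eq 0) => // n.
rewrite (@prefix_cat n [::] (P n)) => // e /limit_edgeP/abP[]; lra.
Qed.

Lemma sigma_end : sigma 1 = pt t.
Proof.
rewrite sigma_out; last by move=> e [/abP[_ _ b1]]; lra.
congr pt; apply: (@position_eq 1) => // n.
rewrite (@prefix_cat n (P n) [::]) ?cats0//; first exact: coh_walk cP n.
by move=> e /limit_edgeP/abP[].
Qed.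

Definition walk_points : set (fpoint R G) := sigma @` `[0, 1].

Definition walk_lt p q := exists x y,
  [/\ 0 <= x <= 1, 0 <= y <= 1, sigma x = p, sigma y = q & x < y].

Lemma sigma_inj x y : inner_points (sigma x) -> sigma x = sigma y -> x = y.
Proof.
move=> [e _ [z _ zE]] xy; have [[le _] zx] := inner_sigma (esym zE).
rewrite xy in zE; have [_ zy] := inner_sigma (esym zE).
by case: (ltgtP x y) => //; rewrite -(param_lt _ _ le) -zx -zy ltxx.
Qed.

Lemma walk_ltP x y : 0 <= x <= 1 -> 0 <= y <= 1 ->
  inner_points (sigma x) -> inner_points (sigma y) ->
  (walk_lt (sigma x) (sigma y) <-> x < y).
Proof.
move=> x01 y01 ix iy; split=> [[x' [y' [_ _ xE yE]]]|xy]; last by exists x, y.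
by rewrite (sigma_inj ix (esym xE)) (sigma_inj iy (esym yE)).
Qed.

Lemma sigma_witness : is_witness walk_points walk_lt sigma.
Proof.
split=> //.
- exact: continuous_subspaceT sigma_continuous.
- move=> p [ip [x]]; rewrite /= in_itv /= => x01 xp; exists x; split=> // y [_ yp].
  by apply: sigma_inj; rewrite xp.
- exact: walk_ltP.
Qed.

Lemma walk_lt_linear : strict_linear_order_on (inner_points `&` walk_points) walk_lt.
Proof.
have itv p : walk_points p -> exists2 x, 0 <= x <= 1 & sigma x = p.
  by move=> [x]; rewrite /= in_itv /=; exists x.
split.
- move=> p [ip /itv[x x01 E]]; rewrite -E in ip *.
  by move=> /(walk_ltP x01 x01 ip ip); rewrite ltxx.
- move=> p q r [ip /itv[x x01 E]] [iq /itv[y y01 E']] [ir /itv[z z01 E'']].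
  rewrite -E -E' -E'' in ip iq ir *.
  move=> /(walk_ltP x01 y01 ip iq) xy /(walk_ltP y01 z01 iq ir) yz.
  by apply/walk_ltP => //; exact: lt_trans yz.
- move=> p q [ip /itv[x x01 E]] [iq /itv[y y01 E']]; rewrite -E -E' in ip iq *.
  move=> nxy; have [xy|yx|xy] := ltgtP x y.
  + by left; apply/walk_ltP.
  + by right; apply/walk_ltP.
  + by exfalso; apply: nxy; rewrite xy.
Qed.

Lemma sigma_directed : directed walk_points walk_lt.
Proof.
move=> e _ p q [ep [x x01 E]] [eq [y y01 E']]; rewrite /= !in_itv /= in x01 y01.
rewrite -E -E' in ep eq *.
have ix : inner_points (sigma x) by exists e.
have iy : inner_points (sigma y) by exists e.
apply: (iff_trans (walk_ltP x01 y01 ix iy)).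
case: ep eq => z _ zE [z' _ zE']; rewrite -zE -zE'.
have [[le _] zx] := inner_sigma (esym zE); have [_ zy] := inner_sigma (esym zE').
by apply: iff_sym; apply: (iff_trans (edge_ltP _ _ _)); rewrite zx zy param_lt.
Qed.

Lemma walk_contained :
  contains_directed_topological_walk (edge_set_closure F) (@pt R G s) (pt t).
Proof.
exists walk_points, walk_lt; split; first by move=> _ [x _ <-]; exact: sigma_closure.
split; [|exact: sigma_directed|].
  by split; [exact: walk_lt_linear|exists sigma; exact: sigma_witness].
move=> rho wr; exact: (witness_endpoints lf wc walk_lt_linear sigma_directed
  sigma_witness wr sigma_start sigma_end).
Qed.

End WalkConstruction.

(** * From coherent trails to (i) and (iii) *)

Section Equivalence.
Context {R : realType} {G : digraph} {v0 : vertex G}.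
Hypothesis (lf : locally_finite G) (wc : weakly_connected G).
Context {F : set (edge G)} {s t : @node G} {P : nat -> seq (edge G)}.
Hypothesis (cP : coherent v0 F s t P) (st : s <> t).

Lemma coherent_walk :
  contains_directed_topological_walk (edge_set_closure F) (@pt R G s) (pt t).
Proof.
have [a [b [abP ab_prec]]] := edge_intervals cP R.
have [pos posP] := choice (position_ex lf wc cP abP ab_prec).
have [x|sigma sP] := @choice _ _ (fun x y =>
    (forall e, in_edge (P := P) (a := a) (b := b) x e -> y = edge_point e (param (a := a) (b := b) e x)) /\
    ((forall e, ~ in_edge (P := P) (a := a) (b := b) x e) -> y = pt (pos x))).
  have [[e xe]|out] := pselect (exists e, in_edge (P := P) (a := a) (b := b) x e).
    exists (edge_point e (param (a := a) (b := b) e x)); split=> [f xf|/(_ e)//].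
    by rewrite (in_edge_uniq cP ab_prec xe xf).
  by exists (pt (pos x)); split=> // e xe; exfalso; apply: out; exists e.
apply: (walk_contained lf wc cP st abP ab_prec posP (sigma := sigma)).
- by move=> x e; case: (sP x) => h _; exact: h.
- by move=> x; case: (sP x).
Qed.

Lemma ecard_seq (A : set (edge G)) (l : seq (edge G)) : uniq l ->
  (forall e, A e <-> e \in l) -> ecard A = size l.
Proof.
move=> ul Al; rewrite /ecard.
have -> : fset_set A = [fset e in l]%fset.
  apply/fsetP => e; rewrite in_fset_set.
    by rewrite !inE; apply/idP/idP => [/asboolP/Al|/Al/asboolP].
  by apply/finite_seqP; exists l; apply/seteqP; split=> x /Al.
by rewrite card_fseq undup_id.
Qed.

(** At a level where [X] is saturated no edge of the cut is contracted, so all limit edges in the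
    cut occur in one trail, to which [walk_count] applies. *)
Lemma coherent_balance X : finite_set (edges_between X (~` X)) ->
  side X s -> side (~` X) t ->
  ecard (limit_edge P `&` edges_from X (~` X)) =
  (ecard (limit_edge P `&` edges_from (~` X) X) + 1)%N.
Proof.
move=> fX Xs Xt; have [n sX] := finite_saturated v0 lf wc fX.
have card Y Z : (forall e, edges_from Y Z e -> edges_between X (~` X) e) ->
    ecard (limit_edge P `&` edges_from Y Z) =
    count [pred e | `[< edges_from Y Z e >]] (P n).
  move=> YZ; rewrite -size_filter; apply: ecard_seq.
    by apply: filter_uniq; exact: coh_uniq cP n.
  move=> e; rewrite mem_filter /=; split=> [[le eYZ]|/andP[/asboolP eYZ en]].
    apply/andP; split; first exact/asboolP.
    by apply: (coh_mem cP le); apply: (saturated_nonloop sX); exact: YZ.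
  by split=> //; exists n.
rewrite !card; [|by right|by left].
have := walk_count lf sX (coh_walk cP n).
by rewrite (asboolT Xs) (asboolF (proj1 (sideC lf t sX) Xt)) addn0.
Qed.

End Equivalence.

Theorem lemma3p1 (R : realType) (G : digraph)
    (lfG : locally_finite G) (wcG : weakly_connected G)
    (s t : fpoint R G) (hs : vertices_and_ends s) (ht : vertices_and_ends t)
    (st : s <> t) (F : set (edge G)) :
  let i := contains_directed_topological_walk (edge_set_closure F) s t in
  let ii := forall X Y : set (vertex G), finite_cut X Y ->
    vertex_set_closure X s -> vertex_set_closure Y t ->
    (1 <= ecard (F `&` edges_from X Y))%N in
  let iii := exists2 W : set (edge G), W `<=` F &
    forall X Y : set (vertex G), finite_cut X Y ->
    vertex_set_closure X s -> vertex_set_closure Y t ->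
    ecard (W `&` edges_from X Y) = (ecard (W `&` edges_from Y X) + 1)%N in
  (i <-> ii) /\ (ii <-> iii).
Proof.
move=> i ii iii.
have [p sE] := vertices_and_endsP hs; have [q tE] := vertices_and_endsP ht.
have [v0] := node_vertex p.
have pq : p <> q by move=> E; apply: st; rewrite sE tE E.
(* [ecard] is a true cardinality only on finite sets. *)
have from_finite (X Y : set (vertex G)) : finite_cut X Y -> finite_set (edges_from X Y).
  by move=> [_]; apply: sub_finite_set => e ?; left.
have coh : ii -> exists P, coherent v0 F p q P.
  move=> h; apply: coherent_ex => // X fX Xp Yq.
  have XY : finite_cut X (~` X).
    split=> //; split; [| |exact: setICr|exact: setUv].
    - have [n sX] := finite_saturated v0 lfG wcG fX; have [v pv] := cls_ex v0 lfG n p.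
      by exists v; apply/(side_cls lfG sX pv).
    - have [n sX] := finite_saturated v0 lfG wcG fX; have [v qv] := cls_ex v0 lfG n q.
      by exists v; apply/(side_cls lfG (saturatedC sX) qv).
  have := h _ _ XY; rewrite sE tE => /(_ (side_closure Xp) (side_closure Yq)).
  move=> c; apply: contrapT => /nonemptyPn E; move: c.
  by rewrite E /ecard fset_set0 cardfs0.
split; split.
- rewrite /i /ii sE tE => wF X Y XY Xs Yt; apply: ecard_gt0.
    by apply: sub_finite_set (from_finite _ _ XY) => e [].
  exact: cut_edge_of_walk wF XY Xs Yt.
- move=> /coh[P cP]; rewrite /i sE tE; exact: coherent_walk cP pq.
- move=> /coh[P cP]; exists (limit_edge P); first by move=> e; exact: (limit_edgeF cP).
  move=> X Y [/cutC -> fX]; rewrite sE tE => Xs Yt.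
  have [n sX] := finite_saturated v0 lfG wcG fX.
  apply: (coherent_balance lfG wcG cP fX); first exact: closure_side sX Xs.
  exact: closure_side (saturatedC sX) Yt.
- move=> [W WF h] X Y XY Xs Yt; apply: ecard_gt0.
    by apply: sub_finite_set (from_finite _ _ XY) => e [].
  (* Without an edge of [F] from [X] to [Y], the left side of the equation in (iii) would be 0, but
     the right side is positive. *)
  apply: contrapT => /nonemptyPn E; have := h _ _ XY Xs Yt.
  have -> : W `&` edges_from X Y = set0.
    by rewrite -subset0 -E => e [/WF].
  by rewrite /ecard fset_set0 cardfs0 addn1.
Qed.
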